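(* Let $p$ be a prime and let $G$ be a torsion-free pro-$p$ Demushkin group. Then the completed group algebra $\mathbb{F}_p[[G]]$ has no non-trivial zero-divisors; that is, if $a,b\in \mathbb{F}_p[[G]]$ are nonzero then $ab\neq 0$.
   Context: A pro-$p$ Demushkin group is a (topologically) finitely generated one-relator pro-$p$ group $G$, i.e. $\dim_{\mathbb{F}_p} H^1(G,\mathbb{F}_p)<\infty$ and $\dim_{\mathbb{F}_p} H^2(G,\mathbb{F}_p)=1$, such that the cup product $H^1(G,\mathbb{F}_p)\times H^1(G,\mathbb{F}_p)\to H^2(G,\mathbb{F}_p)$ is non-degenerate (continuous cohomology with trivial coefficients). The completed group algebra is $\mathbb{F}_p[[G]]=\varprojlim_{N} \mathbb{F}_p[G/N]$, where $N$ runs over the open normal subgroups of $G$. *)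

(* Defs.v *)
From HB Require Import structures.
From mathcomp Require Import all_boot all_order all_algebra finmap.
From mathcomp Require Import generic_quotient ring_quotient.
From mathcomp Require Import all_classical topology.
From mathcomp Require Import ring.

Set Implicit Arguments.
Unset Strict Implicit.
Unset Printing Implicit Defensive.

Import GRing.Theory.

Local Open Scope classical_set_scope.
Local Open Scope ring_scope.
Local Open Scope quotient_scope.

HB.mixin Record isTopologicalGroup G of Group G & Topological G := {
  mulg_continuous : continuous (fun xy : G * G => (xy.1 * xy.2)%g);
  invg_continuous : continuous (fun x : G => x^-1%g)
}.

#[short(type="topologicalGroupType")]
HB.structure Definition TopologicalGroup :=
  {G of Group G & Topological G & isTopologicalGroup G}.

Record normalSubgroup (G : groupType) := NormalSubgroup {
  normal_set :> set G;
  normal1 : normal_set 1%g;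
  normalM : forall x y, normal_set x -> normal_set y -> normal_set (x * y)%g;
  normalV : forall x, normal_set x -> normal_set x^-1%g;
  normalJ : forall x y, normal_set x -> normal_set (x ^ y)%g
}.

Record openNormalSubgroup (G : topologicalGroupType) := OpenNormalSubgroup {
  openNormal_normal :> normalSubgroup G;
  openNormal_open : open (openNormal_normal : set G)
}.

Section QuotientGroup.
Variables (G : groupType) (N : normalSubgroup G).
Implicit Types x y z : G.

Definition coset_rel x y : bool := `[< normal_set N (x^-1 * y)%g >].

Lemma coset_rel_equiv : equiv_class_of coset_rel.
Proof.
split=> [x|x y|y x z]; rewrite /coset_rel.
- by apply/asboolP; rewrite mulVg; exact: normal1.
- by apply/asbool_equiv_eq; split=> /(@normalV _ N); rewrite invgM invgK.
move=> /asboolP xy /asboolP yz; apply/asboolP.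
by have := normalM xy yz; rewrite mulgA mulgK.
Qed.

Canonical coset_equiv := EquivRelPack coset_rel_equiv.
Canonical coset_encModRel := defaultEncModRel coset_rel.

Definition quotientGroup := {eq_quot coset_rel}.

HB.instance Definition _ :=
  EqQuotient.on quotientGroup.
HB.instance Definition _ := Choice.on quotientGroup.

Definition coset x : quotientGroup := \pi x.

Lemma coset_eqP x y : coset x = coset y <-> normal_set N (x^-1 * y)%g.
Proof.
split=> [/eqP|xy]; last by apply/eqP; rewrite /coset piE; apply/asboolP.
by rewrite /coset piE => /asboolP.
Qed.

Lemma coset_repr (a : quotientGroup) : coset (repr a) = a.
Proof. exact: reprK. Qed.

Definition quotientGroup_one := coset 1%g.
Definition quotientGroup_mul (a b : quotientGroup) := coset (repr a * repr b)%g.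
Definition quotientGroup_inv (a : quotientGroup) := coset (repr a)^-1%g.

Lemma coset_mul x y : coset (x * y)%g = quotientGroup_mul (coset x) (coset y).
Proof.
apply/coset_eqP.
have /coset_eqP xx : coset x = coset (repr (coset x)) by rewrite coset_repr.
have /coset_eqP yy : coset y = coset (repr (coset y)) by rewrite coset_repr.
set x' := repr _ in xx *; set y' := repr _ in yy *.
have := normalM (normalJ y xx) yy; rewrite /conjg invgM !mulgA.
by rewrite -[(_ * y * y^-1)%g]mulgA mulgV mulg1.
Qed.

Lemma coset_inv x : coset x^-1%g = quotientGroup_inv (coset x).
Proof.
apply/coset_eqP.
have /coset_eqP xx : coset x = coset (repr (coset x)) by rewrite coset_repr.
set x' := repr _ in xx *.
have := normalJ x^-1%g (normalV xx).
by rewrite /conjg invgK invgM invgK !mulgA mulgK.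
Qed.

Let mulA : associative quotientGroup_mul.
Proof.
move=> a b c; rewrite -(coset_repr a) -(coset_repr b) -(coset_repr c).
by rewrite -!coset_mul mulgA.
Qed.
Let mul1 : left_id quotientGroup_one quotientGroup_mul.
Proof. by move=> a; rewrite -(coset_repr a) -coset_mul mul1g. Qed.
Let mulr1 : right_id quotientGroup_one quotientGroup_mul.
Proof. by move=> a; rewrite -(coset_repr a) -coset_mul mulg1. Qed.
Let mulV : left_inverse quotientGroup_one quotientGroup_inv quotientGroup_mul.
Proof. by move=> a; rewrite -(coset_repr a) -coset_inv -coset_mul mulVg. Qed.
Let mulrV : right_inverse quotientGroup_one quotientGroup_inv quotientGroup_mul.
Proof. by move=> a; rewrite -(coset_repr a) -coset_inv -coset_mul mulgV. Qed.

HB.instance Definition _ :=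
  isGroup.Build quotientGroup mulA mul1 mulr1 mulV mulrV.

End QuotientGroup.

Lemma cosetM (G : groupType) (N : normalSubgroup G) (x y : G) :
  coset N (x * y)%g = (coset N x * coset N y)%g.
Proof. exact: coset_mul. Qed.

Lemma coset1 (G : groupType) (N : normalSubgroup G) : coset N 1%g = 1%g.
Proof. by []. Qed.

Section QuotientMap.
Variables (G : groupType) (N M : normalSubgroup G).

(* This is the canonical map [G/N -> G/M] only when [N `<=` M]. *)
Definition quotientMap (a : quotientGroup N) : quotientGroup M :=
  coset M (repr a).

Hypothesis sNM : N `<=` M.

Lemma quotientMap_coset x : quotientMap (coset N x) = coset M x.
Proof. by apply/coset_eqP/sNM/coset_eqP; rewrite coset_repr. Qed.

Lemma quotientMap1 : quotientMap 1%g = 1%g.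
Proof. by rewrite -(coset1 N) quotientMap_coset coset1. Qed.

Lemma quotientMapM : {morph quotientMap : a b / (a * b)%g}.
Proof.
move=> a b; rewrite -(coset_repr a) -(coset_repr b) -cosetM.
by rewrite !quotientMap_coset cosetM.
Qed.

End QuotientMap.

Definition profinite_group (G : topologicalGroupType) : Prop :=
  [/\ compact [set: G], hausdorff_space G & totally_disconnected [set: G]].

Definition pro_p_group (p : nat) (G : topologicalGroupType) : Prop :=
  profinite_group G /\
  forall N : openNormalSubgroup G,
    exists k, ([set: quotientGroup N] #= `I_(p ^ k))%card.

Definition torsion_free (G : groupType) : Prop :=
  forall (x : G) (n : nat), (0 < n)%N -> (x ^+ n = 1)%g -> x = 1%g.

Definition has_dim (K : fieldType) (V : lmodType K) (n : nat) : Prop :=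
  exists e : 'I_n -> V,
    forall v, exists! c : 'I_n -> K, v = \sum_(i < n) c i *: e i.

Definition finite_dim (K : fieldType) (V : lmodType K) : Prop :=
  exists n, has_dim V n.

Section Homology.
Variables (K : pzRingType) (U V W : lmodType K).
Variables (f : {linear U -> V}) (g : {linear V -> W}).

Definition cycle_pred : {pred V} := fun v => g v == 0.

Lemma cycle_submod : subsemimod_closed cycle_pred.
Proof.
split; first split.
- by rewrite unfold_in linear0.
- by move=> u v; rewrite !unfold_in linearD => /eqP-> /eqP->; rewrite addr0.
by move=> k v; rewrite !unfold_in linearZ /= => /eqP->; rewrite scaler0.
Qed.

HB.instance Definition _ := GRing.isSubmodClosed.Build K V cycle_pred cycle_submod.

Definition cycles := {v : V | v \in cycle_pred}.

HB.instance Definition _ := [isSub of cycles for @sval _ _].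
HB.instance Definition _ := [Choice of cycles by <:].
HB.instance Definition _ := [SubChoice_isSubLmodule of cycles by <:].

Definition boundary_pred : {pred cycles} :=
  fun v => `[< exists u, f u = val v >].

Lemma boundary_submod : subsemimod_closed boundary_pred.
Proof.
split; first split.
- by apply/asboolP; exists 0; rewrite !raddf0.
- move=> u v /asboolP[a fa] /asboolP[b fb].
  by apply/asboolP; exists (a + b); rewrite !raddfD /= fa fb.
move=> k v /asboolP[a fa].
by apply/asboolP; exists (k *: a); rewrite !linearZ /= fa.
Qed.

HB.instance Definition _ :=
  GRing.isSubmodClosed.Build K cycles boundary_pred boundary_submod.

Definition homology := Quotient.quot boundary_pred.

HB.instance Definition _ := GRing.Zmodule.on homology.

Definition homology_class (v : cycles) : homology := \pi v.

Lemma homology_classE u v :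
  homology_class u = homology_class v <-> exists a, f a = val u - val v.
Proof.
rewrite -raddfB; split=> [/eqP|fa].
  by rewrite /homology_class -Quotient.idealrBE => /asboolP.
by apply/eqP; rewrite /homology_class -Quotient.idealrBE; apply/asboolP.
Qed.

Definition homology_scale (k : K) (a : homology) : homology :=
  homology_class (k *: repr a).

Lemma homology_class_repr (a : homology) : homology_class (repr a) = a.
Proof. exact: reprK. Qed.

Let classD : {morph homology_class : u v / u + v}.
Proof. exact: Quotient.pi_add. Qed.
Let classZ k v : homology_class (k *: v) = homology_scale k (homology_class v).
Proof.
apply/eqP; rewrite -Quotient.idealrBE -scalerBr rpredZ //.
by rewrite Quotient.idealrBE reprK.
Qed.

Let scaleA k l a :
  homology_scale k (homology_scale l a) = homology_scale (k * l) a.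
Proof. by rewrite -(homology_class_repr a) -!classZ scalerA. Qed.
Let scale1 : left_id 1 homology_scale.
Proof. by move=> a; rewrite -(homology_class_repr a) -classZ scale1r. Qed.
Let scaleDr : right_distributive homology_scale +%R.
Proof.
move=> k a b; rewrite -(homology_class_repr a) -(homology_class_repr b).
by rewrite -!classZ -!classD -classZ scalerDr classD.
Qed.
Let scaleDl a : {morph homology_scale^~ a : k l / k + l}.
Proof.
by move=> k l; rewrite -(homology_class_repr a) -!classZ scalerDl classD.
Qed.

HB.instance Definition _ :=
  GRing.Zmodule_isLmodule.Build K homology scaleA scale1 scaleDr scaleDl.

Lemma homology_class_linear : linear homology_class.
Proof. by move=> k u v; rewrite classD classZ. Qed.

HB.instance Definition _ :=
  GRing.isLinear.Build K cycles homology _ homology_class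
    homology_class_linear.

End Homology.

(* Inhomogeneous continuous cochains with values in the field [F], which carries
   the discrete topology and the trivial action of [G]. *)

Section Cochains.
Variables (F : fieldType) (X : topologicalType).

Definition cochain_pred : {pred X -> F^o} :=
  fun f => `[< continuous (f : X -> discrete_topology F) >].

Lemma cochain_predP (f : X -> F^o) :
  f \in cochain_pred <-> forall x, \forall y \near x, f y = f x.
Proof.
split=> [/asboolP cf x|cf].
  by apply: (cf x [set a | a = f x]); move=> y ->.
apply/asboolP => x A Afx; apply: filterS (cf x) => y /= ->.
exact: Afx.
Qed.

Lemma cochain_submod : subsemimod_closed cochain_pred.
Proof.
split; first split.
- by apply/cochain_predP => x; near=> y.
- move=> f g /cochain_predP cf /cochain_predP cg; apply/cochain_predP => x.
  by near=> y; congr (_ + _); near: y; [exact: cf|exact: cg].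
move=> k f /cochain_predP cf; apply/cochain_predP => x.
by near=> y; congr (_ *: _); near: y; exact: cf.
Unshelve. all: by end_near. Qed.

HB.instance Definition _ :=
  GRing.isSubmodClosed.Build F (X -> F^o) cochain_pred cochain_submod.

Definition cochain := {f : X -> F^o | f \in cochain_pred}.

HB.instance Definition _ := [isSub of cochain for @sval _ _].
HB.instance Definition _ := [Choice of cochain by <:].
HB.instance Definition _ := [SubChoice_isSubLmodule of cochain by <:].

Definition cochain_fun (f : cochain) : X -> F := val f.
Coercion cochain_fun : cochain >-> Funclass.

Lemma cochainP (f g : cochain) : f =1 g -> f = g.
Proof. by move=> fg; apply/val_inj/funext. Qed.

Lemma cochain_near (f : cochain) (x : X) : \forall y \near x, f y = f x.
Proof. exact: (cochain_predP (val f)).1 (valP f) x. Qed.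

Lemma cochainDZ (k : F) (f g : cochain) x : cochain_fun (k *: f + g) x = k * f x + g x.
Proof. by []. Qed.

End Cochains.

Arguments cochain_pred : clear implicits.

Lemma cochain_comp (F : fieldType) (X Y : topologicalType) (f : cochain F Y)
    (h : X -> Y) :
  continuous h -> (f \o h : X -> F^o) \in cochain_pred F X.
Proof.
move=> hc; apply/cochain_predP => x.
exact: hc x _ (cochain_near f (h x)).
Qed.

Section Cohomology.
Variables (F : fieldType) (G : topologicalGroupType).
Local Notation C1 := (cochain F G).
Local Notation C2 := (cochain F (G * G)%type).
Local Notation C3 := (cochain F (G * G * G)%type).

Definition bar1_fun (f : C1) : G * G -> F^o :=
  fun '(x, y) => f y - f (x * y)%g + f x.

Definition bar2_fun (f : C2) : G * G * G -> F^o :=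
  fun '(x, y, z) => f (y, z) - f ((x * y)%g, z) + f (x, (y * z)%g) - f (x, y).

Lemma continuous_mul (X : topologicalType) (u v : X -> G) :
  continuous u -> continuous v -> continuous (fun x => (u x * v x)%g).
Proof.
move=> uc vc x.
apply: (@continuous_comp _ _ _ (fun x => (u x, v x)) (fun xy => xy.1 * xy.2)%g).
  by apply: cvg_pair; [exact: uc|exact: vc].
exact: mulg_continuous.
Qed.

Lemma continuous_pair (X Y Z : topologicalType) (u : X -> Y) (v : X -> Z) :
  continuous u -> continuous v -> continuous (fun x => (u x, v x)).
Proof. by move=> uc vc x; apply: cvg_pair; [exact: uc|exact: vc]. Qed.

Let cont1 (X Y Z : topologicalType) (u : X -> Y * Z) :
  continuous u -> continuous (fun x => (u x).1).
Proof. by move=> uc x; apply: continuous_comp; [exact: uc|exact: cvg_fst]. Qed.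
Let cont2 (X Y Z : topologicalType) (u : X -> Y * Z) :
  continuous u -> continuous (fun x => (u x).2).
Proof. by move=> uc x; apply: continuous_comp; [exact: uc|exact: cvg_snd]. Qed.
Let contid (X : topologicalType) : continuous (fun x : X => x).
Proof. by move=> x; exact: cvg_id. Qed.

Lemma bar1_cochain f : bar1_fun f \in cochain_pred F (G * G)%type.
Proof.
have -> : bar1_fun f = (f \o snd : _ -> F^o)
    - (f \o (fun xy => xy.1 * xy.2)%g : _ -> F^o) + (f \o fst : _ -> F^o).
  by apply/funext => -[x y].
apply: rpredD; [apply: rpredB|]; apply: cochain_comp.
- exact/cont2/contid.
- exact: mulg_continuous.
- exact/cont1/contid.
Qed.

Lemma bar2_cochain f : bar2_fun f \in cochain_pred F (G * G * G)%type.
Proof.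
have -> : bar2_fun f = (f \o (fun t => (t.1.2, t.2)) : _ -> F^o)
    - (f \o (fun t => (t.1.1 * t.1.2, t.2))%g : _ -> F^o)
    + (f \o (fun t => (t.1.1, t.1.2 * t.2))%g : _ -> F^o)
    - (f \o fst : _ -> F^o).
  by apply/funext => -[[x y] z].
have c11 : continuous (fun t : G * G * G => t.1.1) by exact/cont1/cont1/contid.
have c12 : continuous (fun t : G * G * G => t.1.2) by exact/cont2/cont1/contid.
have c2 : continuous (fun t : G * G * G => t.2) by exact/cont2/contid.
apply: rpredB; [apply: rpredD; [apply: rpredB|]|]; apply: cochain_comp.
- exact: continuous_pair.
- exact: continuous_pair (continuous_mul c11 c12) c2.
- exact: continuous_pair c11 (continuous_mul c12 c2).
- exact/cont1/contid.
Qed.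

Definition bar1 (f : C1) : C2 := Sub (bar1_fun f) (bar1_cochain f).
Definition bar2 (f : C2) : C3 := Sub (bar2_fun f) (bar2_cochain f).

Lemma bar1E f x y : bar1 f (x, y) = f y - f (x * y)%g + f x.
Proof. by []. Qed.

Lemma bar2E f x y z : bar2 f (x, y, z) =
  f (y, z) - f ((x * y)%g, z) + f (x, (y * z)%g) - f (x, y).
Proof. by []. Qed.

Lemma bar1_linear : linear bar1.
Proof.
by move=> k f g; apply: cochainP => -[x y]; rewrite cochainDZ !bar1E !cochainDZ; ring.
Qed.

Lemma bar2_linear : linear bar2.
Proof.
move=> k f g; apply: cochainP => -[[x y] z].
by rewrite cochainDZ !bar2E !cochainDZ; ring.
Qed.

HB.instance Definition _ := GRing.isLinear.Build F C1 C2 _ bar1 bar1_linear.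
HB.instance Definition _ := GRing.isLinear.Build F C2 C3 _ bar2 bar2_linear.

Lemma bar2_bar1 f : bar2 (bar1 f) = 0.
Proof.
apply: cochainP => -[[x y] z]; rewrite bar2E !bar1E !mulgA.
by rewrite [RHS](_ : _ = 0) //; ring.
Qed.

(* [C^0 = F], and the differential [C^0 -> C^1] is zero because [G] acts
   trivially on [F]. *)
Definition H1 := homology (\0 : {linear F^o -> C1}) bar1.
Definition H2 := homology bar1 bar2.

Lemma H1_cocycleP (f : C1) :
  f \in cycle_pred bar1 <-> forall x y, f (x * y)%g = f x + f y.
Proof.
split=> [/eqP fc x y|fM].
  have : bar1 f (x, y) = 0 by rewrite fc.
  by rewrite bar1E => /eqP; rewrite addrAC subr_eq0 addrC => /eqP.
apply/eqP/cochainP => -[x y]; rewrite bar1E fM.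
by rewrite [RHS](_ : _ = 0) //; ring.
Qed.

Definition cup_fun (f g : C1) : G * G -> F^o := fun '(x, y) => f x * g y.

Lemma cup_cochain f g : cup_fun f g \in cochain_pred F (G * G)%type.
Proof.
have fc : (f \o fst : G * G -> F^o) \in cochain_pred F (G * G)%type.
  by apply: cochain_comp; exact/cont1/contid.
have gc : (g \o snd : G * G -> F^o) \in cochain_pred F (G * G)%type.
  by apply: cochain_comp; exact/cont2/contid.
apply/cochain_predP => -[x y].
move/cochain_predP: fc => /(_ (x, y)); move/cochain_predP: gc => /(_ (x, y)).
by apply: filterS2 => -[x' y'] /= -> ->.
Qed.

Definition cup_cochains f g : C2 := Sub (cup_fun f g) (cup_cochain f g).

Lemma cup_cochainsE f g x y : cup_cochains f g (x, y) = f x * g y.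
Proof. by []. Qed.

Lemma cup_cocycle (f g : cycles bar1) :
  cup_cochains (val f) (val g) \in cycle_pred bar2.
Proof.
apply/eqP/cochainP => -[[x y] z]; rewrite bar2E !cup_cochainsE.
have /H1_cocycleP-> := valP f; have /H1_cocycleP-> := valP g.
by rewrite [RHS](_ : _ = 0) //; ring.
Qed.

Definition cup_cocycles (f g : cycles bar1) : cycles bar2 :=
  Sub (cup_cochains (val f) (val g)) (cup_cocycle f g).

(* The choice of representatives is irrelevant, see [cup_class]. *)
Definition cup (a b : H1) : H2 :=
  homology_class bar1 (cup_cocycles (repr a) (repr b)).

Lemma cup_class (f g : cycles bar1) :
  cup (homology_class _ f) (homology_class _ g) =
  homology_class bar1 (cup_cocycles f g).
Proof.
have repr_class (h : cycles bar1) :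
    repr (homology_class (\0 : {linear F^o -> C1}) h) = h.
  have /homology_classE[a] := homology_class_repr
    (homology_class (\0 : {linear F^o -> C1}) h).
  by move=> /esym/eqP; rewrite subr_eq0 => /eqP/val_inj.
by rewrite /cup !repr_class.
Qed.

End Cohomology.

Definition demushkin_group (p : nat) (G : topologicalGroupType) : Prop :=
  [/\ pro_p_group p G,
      finite_dim (H1 'F_p G),
      has_dim (H2 'F_p G) 1 &
      (forall a : H1 'F_p G, (forall b, cup a b = 0) -> a = 0) /\
      (forall b : H1 'F_p G, (forall a, cup a b = 0) -> b = 0)].

(* Finitely supported functions; the product is the convolution, see [monomialM]
   and [gaME]. *)
Definition groupAlgebra (R : nzRingType) (Q : groupType) :=
  {fsfun Q -> R with 0}.

Section GroupAlgebraZmodule.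
Variables (R : nzRingType) (Q : groupType).
Local Notation A := (groupAlgebra R Q).
Implicit Types f g h : A.

HB.instance Definition _ := Choice.on A.

Definition ga_zero : A := [fsfun].
Definition ga_opp f : A := [fsfun x in finsupp f => - f x].
Definition ga_add f g : A :=
  [fsfun x in (finsupp f `|` finsupp g)%fset => f x + g x].

Let zeroE x : ga_zero x = 0. Proof. exact: fsfun0E. Qed.

Let oppE f x : ga_opp f x = - f x.
Proof. by rewrite fsfunE; case: ifPn => // /fsfun_dflt->; rewrite oppr0. Qed.

Let addE f g x : ga_add f g x = f x + g x.
Proof.
rewrite fsfunE inE; case: ifPn => //; rewrite negb_or.
by move=> /andP[/fsfun_dflt-> /fsfun_dflt->]; rewrite addr0.
Qed.

Let addA : associative ga_add.
Proof. by move=> f g h; apply/fsfunP => x; rewrite !addE addrA. Qed.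
Let addC : commutative ga_add.
Proof. by move=> f g; apply/fsfunP => x; rewrite !addE addrC. Qed.
Let add0 : left_id ga_zero ga_add.
Proof. by move=> f; apply/fsfunP => x; rewrite addE zeroE add0r. Qed.
Let addN : left_inverse ga_zero ga_opp ga_add.
Proof. by move=> f; apply/fsfunP => x; rewrite addE oppE zeroE addNr. Qed.

HB.instance Definition _ := GRing.isZmodule.Build A addA addC add0 addN.

Lemma gaD f g x : (f + g) x = f x + g x. Proof. exact: addE. Qed.
Lemma ga0 x : (0 : A) x = 0. Proof. exact: zeroE. Qed.

Lemma ga_sumE I (r : seq I) (P : pred I) (F : I -> A) x :
  (\sum_(i <- r | P i) F i) x = \sum_(i <- r | P i) F i x.
Proof. by elim/big_rec2: _ => [|i _ y _ <-]; rewrite ?ga0 ?gaD. Qed.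

Definition monomial (q : Q) (r : R) : A := [fsfun x in [fset q]%fset => r].

Lemma monomialE q r x : monomial q r x = if x == q then r else 0.
Proof. by rewrite fsfunE inE. Qed.

Lemma monomial0 q : monomial q 0 = 0.
Proof. by apply/fsfunP => x; rewrite monomialE ga0 if_same. Qed.

Lemma monomialD q r s : monomial q (r + s) = monomial q r + monomial q s.
Proof.
by apply/fsfunP => x; rewrite gaD !monomialE; case: ifP; rewrite ?addr0.
Qed.

(* The additive extension of [F : Q -> R -> V] from monomials to [R[Q]]. *)
Definition ga_ext (V : zmodType) (F : Q -> R -> V) f : V :=
  \sum_(q <- finsupp f) F q (f q).

Section Ext.
Variables (V : zmodType) (F : Q -> R -> V).
Hypothesis F0 : forall q, F q 0 = 0.
Hypothesis FD : forall q r s, F q (r + s) = F q r + F q s.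

Lemma ga_ext_sub f (S : {fset Q}) : (finsupp f `<=` S)%fset ->
  ga_ext F f = \sum_(q <- S) F q (f q).
Proof.
by move=> fS; apply: big_fset_incl => // q _ qf; rewrite fsfun_dflt.
Qed.

Lemma ga_ext_monomial q r : ga_ext F (monomial q r) = F q r.
Proof.
rewrite (@ga_ext_sub _ [fset q]%fset) ?big_seq_fset1 ?monomialE ?eqxx //.
apply/fsubsetP => x; rewrite mem_finsupp monomialE inE.
by case: ifP => // _; rewrite eqxx.
Qed.

Lemma ga_ext0 : ga_ext F 0 = 0.
Proof. by rewrite -(monomial0 1%g) ga_ext_monomial. Qed.

Lemma ga_extD f g : ga_ext F (f + g) = ga_ext F f + ga_ext F g.
Proof.
set S := (finsupp f `|` finsupp g)%fset.
rewrite (@ga_ext_sub f S) ?fsubsetUl// (@ga_ext_sub g S) ?fsubsetUr//.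
rewrite (@ga_ext_sub _ S) -?big_split /=.
  by apply: eq_bigr => q _; rewrite gaD FD.
apply/fsubsetP => x; rewrite inE !mem_finsupp gaD.
by apply: contraR; rewrite negb_or !negbK => /andP[/eqP-> /eqP->]; rewrite addr0.
Qed.

Lemma ga_ext_sum I (r : seq I) (P : pred I) (f : I -> A) :
  ga_ext F (\sum_(i <- r | P i) f i) = \sum_(i <- r | P i) ga_ext F (f i).
Proof. by elim/big_rec2: _ => [|i _ y _ <-]; rewrite ?ga_ext0 ?ga_extD. Qed.

End Ext.

Lemma ga_decomp f : f = ga_ext monomial f.
Proof.
apply/fsfunP => x; rewrite ga_sumE.
under eq_bigr do rewrite monomialE.
case: (finsuppP f x) => xf.
  by rewrite big1_fset // => q qf _; case: eqP => // qx; rewrite qx qf in xf.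
rewrite (big_fsetD1 x xf) /= eqxx big1_fset ?addr0 // => q.
by rewrite !inE eq_sym => /andP[/negPf-> _].
Qed.

Lemma ga_ind (P : A -> Prop) : (forall q r, P (monomial q r)) ->
  P 0 -> (forall f g, P f -> P g -> P (f + g)) -> forall f, P f.
Proof.
move=> Pm P0 PD f; rewrite (ga_decomp f) /ga_ext.
by elim/big_rec: _ => // q g _; exact: PD.
Qed.

End GroupAlgebraZmodule.

Section GroupAlgebraRing.
Variables (R : nzRingType) (Q : groupType).
Local Notation A := (groupAlgebra R Q).
Implicit Types f g h : A.

Definition ga_one : A := monomial 1%g 1.
Definition ga_mul f g : A :=
  \sum_(x <- finsupp f) \sum_(y <- finsupp g) monomial (x * y)%g (f x * g y).

Let term (g : A) (x : Q) (r : R) : A :=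
  ga_ext (fun y s => monomial (x * y)%g (r * s)) g.

Let mulE f g : ga_mul f g = ga_ext (term g) f. Proof. by []. Qed.

Let term0 g x : term g x 0 = 0.
Proof. by rewrite /term /ga_ext big1// => y _; rewrite mul0r monomial0. Qed.

Let termD g x r s : term g x (r + s) = term g x r + term g x s.
Proof.
rewrite /term /ga_ext -big_split /=.
by apply: eq_bigr => y _; rewrite mulrDl monomialD.
Qed.

Let inner0 x r y : monomial (x * y)%g (r * 0) = 0 :> A.
Proof. by rewrite mulr0 monomial0. Qed.

Let innerD x r y s t : monomial (x * y)%g (r * (s + t)) =
  monomial (x * y)%g (r * s) + monomial (x * y)%g (r * t) :> A.
Proof. by rewrite mulrDr monomialD. Qed.

Let mul0l f : ga_mul 0 f = 0.
Proof. by rewrite mulE ga_ext0. Qed.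

Let mulDl : left_distributive ga_mul +%R.
Proof. by move=> f g h; rewrite !mulE ga_extD. Qed.

Let mul0r' f : ga_mul f 0 = 0.
Proof. by rewrite mulE /ga_ext big1// => x _; exact: ga_ext0. Qed.

Let mulDr : right_distributive ga_mul +%R.
Proof.
move=> f g h; rewrite !mulE /ga_ext -big_split /=.
by apply: eq_bigr => x _; exact: ga_extD.
Qed.

Lemma ga_mul_monomial x r y s :
  ga_mul (monomial x r) (monomial y s) = monomial (x * y)%g (r * s).
Proof. by rewrite mulE ga_ext_monomial // /term ga_ext_monomial. Qed.

Let mulA : associative ga_mul.
Proof.
move=> f g h.
elim/ga_ind: f => [x r||f f' Hf Hf']; rewrite ?mul0l ?mulDl ?Hf ?Hf'//.
elim/ga_ind: g => [y s||g g' Hg Hg'];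
  rewrite ?(mul0l, mul0r') ?(mulDl, mulDr) ?(mulDl, mulDr) ?Hg ?Hg'//.
elim/ga_ind: h => [z t||h h' Hh Hh'];
  rewrite ?(mul0l, mul0r') ?(mulDl, mulDr) ?(mulDl, mulDr) ?Hh ?Hh'//.
by rewrite !ga_mul_monomial mulrA mulgA.
Qed.

Let mul1l : left_id ga_one ga_mul.
Proof.
move=> f; elim/ga_ind: f => [x r||f f' Hf Hf'].
- by rewrite ga_mul_monomial mul1r mul1g.
- exact: mul0r'.
- by rewrite mulDr Hf Hf'.
Qed.

Let mul1r' : right_id ga_one ga_mul.
Proof.
move=> f; elim/ga_ind: f => [x r||f f' Hf Hf'].
- by rewrite ga_mul_monomial mulr1 mulg1.
- exact: mul0l.
- by rewrite mulDl Hf Hf'.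
Qed.

Let one_neq0 : ga_one != 0.
Proof.
apply/eqP => /fsfunP/(_ 1%g)/eqP.
by rewrite ga0 monomialE eqxx oner_eq0.
Qed.

HB.instance Definition _ := GRing.Zmodule_isNzRing.Build A
  mulA mul1l mul1r' mulDl mulDr one_neq0.

Lemma monomialM x r y s :
  monomial x r * monomial y s = monomial (x * y)%g (r * s) :> A.
Proof. exact: ga_mul_monomial. Qed.

Lemma ga1E : (1 : A) = monomial 1%g 1. Proof. by []. Qed.

Lemma gaME f g z : (f * g) z = \sum_(x <- finsupp f) f x * g (x^-1 * z)%g.
Proof.
rewrite ga_sumE; apply: eq_bigr => x _; rewrite ga_sumE.
under eq_bigr do rewrite monomialE.
have E y : (z == (x * y)%g) = (y == (x^-1 * z)%g).
  by apply/eqP/eqP => ->; rewrite mulgA ?mulVg ?mulgV mul1g.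
under eq_bigr do rewrite E.
case: (finsuppP g (x^-1 * z)%g) => zg.
  rewrite mulr0 big1_fset // => y yg _; case: eqP => // yz.
  by rewrite yz in yg; rewrite yg in zg.
rewrite (big_fsetD1 _ zg) /= eqxx big1_fset ?addr0 // => y.
by rewrite !inE => /andP[/negPf-> _].
Qed.

End GroupAlgebraRing.

Section GroupAlgebraMap.
Variables (R : nzRingType) (Q Q' : groupType) (phi : Q -> Q').

Definition ga_map (f : groupAlgebra R Q) : groupAlgebra R Q' :=
  \sum_(x <- finsupp f) monomial (phi x) (f x).

Lemma ga_map_monomial x r : ga_map (monomial x r) = monomial (phi x) r.
Proof.
have F0 y : monomial (phi y) 0 = 0 :> groupAlgebra R Q' by exact: monomial0.
exact: (@ga_ext_monomial _ _ _ (fun y s => monomial (phi y) s) F0).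
Qed.

Lemma ga_map_is_nmod_morphism : nmod_morphism ga_map.
Proof.
have F0 x : monomial (phi x) 0 = 0 :> groupAlgebra R Q' by exact: monomial0.
have FD x r s : monomial (phi x) (r + s) =
  monomial (phi x) r + monomial (phi x) s :> groupAlgebra R Q'.
  exact: monomialD.
pose F x r : groupAlgebra R Q' := monomial (phi x) r.
by split=> [|f g]; [exact: (@ga_ext0 _ _ _ F)|exact: (@ga_extD _ _ _ F)].
Qed.

HB.instance Definition _ := GRing.isNmodMorphism.Build
  (groupAlgebra R Q) (groupAlgebra R Q') ga_map ga_map_is_nmod_morphism.

Hypothesis phi1 : phi 1%g = 1%g.
Hypothesis phiM : {morph phi : x y / (x * y)%g}.

Lemma ga_map1 : ga_map 1 = 1.
Proof. by rewrite ga_map_monomial phi1. Qed.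

Lemma ga_mapM : {morph ga_map : f g / f * g}.
Proof.
move=> f g.
elim/ga_ind: f => [x r||f f' Hf Hf'].
- elim/ga_ind: g => [y s||g g' Hg Hg'].
  + by rewrite monomialM !ga_map_monomial monomialM phiM.
  + by rewrite !(mulr0, raddf0).
  + by rewrite mulrDr !raddfD /= Hg Hg' mulrDr.
- by rewrite raddf0 !mul0r raddf0.
- by rewrite mulrDl !raddfD /= Hf Hf' mulrDl.
Qed.

End GroupAlgebraMap.

Section CompletedGroupAlgebra.
Variables (R : nzRingType) (G : topologicalGroupType).

Definition coherent
    (a : forall N : openNormalSubgroup G, groupAlgebra R (quotientGroup N)) :=
  forall N M : openNormalSubgroup G, (N : set G) `<=` M ->
    ga_map (@quotientMap G N M) (a N) = a M.

Record completedGroupAlgebra := CompletedGroupAlgebra {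
  cga_proj :> forall N : openNormalSubgroup G, groupAlgebra R (quotientGroup N);
  cga_coherent : coherent cga_proj
}.
Local Notation A := completedGroupAlgebra.

Lemma cgaP (a b : A) : (forall N, a N = b N) -> a = b.
Proof.
case: a b => [a ac] [b bc] /= ab.
have {}ab : a = b by apply: functional_extensionality_dep.
by rewrite -ab in bc *; congr CompletedGroupAlgebra; exact: Prop_irrelevance.
Qed.

HB.instance Definition _ := gen_eqMixin A.
HB.instance Definition _ := gen_choiceMixin A.

Program Definition cga_zero : A := @CompletedGroupAlgebra (fun=> 0) _.
Next Obligation. by move=> N M _; rewrite raddf0. Qed.

Program Definition cga_opp (a : A) : A :=
  @CompletedGroupAlgebra (fun N => - a N) _.
Next Obligation. by move=> a N M NM; rewrite raddfN /= cga_coherent. Qed.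

Program Definition cga_add (a b : A) : A :=
  @CompletedGroupAlgebra (fun N => a N + b N) _.
Next Obligation. by move=> a b N M NM; rewrite raddfD /= !cga_coherent. Qed.

Program Definition cga_one : A := @CompletedGroupAlgebra (fun=> 1) _.
Next Obligation. by move=> N M NM; rewrite ga_map1 //; exact: quotientMap1. Qed.

Program Definition cga_mul (a b : A) : A :=
  @CompletedGroupAlgebra (fun N => a N * b N) _.
Next Obligation.
move=> a b N M NM; rewrite ga_mapM ?cga_coherent //.
exact: quotientMapM.
Qed.

Let addA : associative cga_add.
Proof. by move=> a b c; apply: cgaP => N; exact: addrA. Qed.
Let addC : commutative cga_add.
Proof. by move=> a b; apply: cgaP => N; exact: addrC. Qed.
Let add0 : left_id cga_zero cga_add.
Proof. by move=> a; apply: cgaP => N; exact: add0r. Qed.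
Let addN : left_inverse cga_zero cga_opp cga_add.
Proof. by move=> a; apply: cgaP => N; exact: addNr. Qed.

HB.instance Definition _ := GRing.isZmodule.Build A addA addC add0 addN.

Let mulA : associative cga_mul.
Proof. by move=> a b c; apply: cgaP => N; exact: mulrA. Qed.
Let mul1l : left_id cga_one cga_mul.
Proof. by move=> a; apply: cgaP => N; exact: mul1r. Qed.
Let mul1r' : right_id cga_one cga_mul.
Proof. by move=> a; apply: cgaP => N; exact: mulr1. Qed.
Let mulDl : left_distributive cga_mul +%R.
Proof. by move=> a b c; apply: cgaP => N; exact: mulrDl. Qed.
Let mulDr : right_distributive cga_mul +%R.
Proof. by move=> a b c; apply: cgaP => N; exact: mulrDr. Qed.

Let setT_normal : normalSubgroup G.
Proof. by exists setT. Defined.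
Let setT_openNormal : openNormalSubgroup G.
Proof. by exists setT_normal; exact: openT. Defined.

Let one_neq0 : cga_one != 0.
Proof.
apply/eqP => /(congr1 (fun a : A => a setT_openNormal))/eqP.
by rewrite /= oner_eq0.
Qed.

HB.instance Definition _ := GRing.Zmodule_isNzRing.Build A
  mulA mul1l mul1r' mulDl mulDr one_neq0.

Lemma cga0 N : (0 : A) N = 0. Proof. by []. Qed.
Lemma cga1 N : (1 : A) N = 1. Proof. by []. Qed.
Lemma cgaN (a : A) N : (- a) N = - a N. Proof. by []. Qed.
Lemma cgaD (a b : A) N : (a + b) N = a N + b N. Proof. by []. Qed.
Lemma cgaM (a b : A) N : (a * b) N = a N * b N. Proof. by []. Qed.

End CompletedGroupAlgebra.

(* Main.v *)
(* Let [C] be the space of locally constant functions on [G]. The dual of [C],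
   or equivalently the algebra of the operators on [C] that commute with the
   left translations, is [A := F_p[[G]]], so that duality of vector spaces
   replaces compactness arguments. Let [chi i] be a basis of [H^1(G, F_p)] and
   let [x i] be operators that kill the constants and satisfy [x i (chi j) =
   delta_ij]. Shifting dimensions in [0 -> F_p -> C -> C^n], where [H^1(G, C) =
   0], shows that [dim H^2 = 1] makes the module of the relations [sum_i v i *
   x i = 0] cyclic, generated by some [r] with [r i = sum_j B i j *: x j]
   modulo the square of the augmentation ideal, where [B] is the matrix of the
   cup product.

   If [n >= 2], the form has an isotropic vector, and one can choose the basis
   such that [r a] starts with [B a b *: x b], [r b] with [B b a *: x a] plus
   terms without [x a], and the other [r i] do not involve [x a]. Giving weight
   2 to [x a] and weight 3 to the other generators, the defining relation
   becomes [B a b *: x b * x a + B b a *: x a * x b] plus terms of higher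
   weight. The words without factor [x b * x a] are a basis of the associated
   graded ring, which is the algebra of a twisted trace monoid, and hence a
   domain.

   If [n = 0], then [A = F_p]. If [n = 1], as the cup square of [chi] is
   nonzero, [C] is spanned by [1] and [chi], so that [G] has order [p], which
   is excluded. *)
From HB Require Import structures.
From mathcomp Require Import all_boot all_order all_algebra finmap.
From mathcomp Require Import all_fingroup all_solvable mxabelem mxrepresentation.
From mathcomp Require Import all_classical topology.
From mathcomp Require Import zify ring generic_quotient.
Require Import Defs.

Set Implicit Arguments.
Unset Strict Implicit.
Unset Printing Implicit Defensive.

Import GRing.Theory.

Local Open Scope ring_scope.

(** * Unipotence of p-groups in characteristic p *)

Section UnipotentRepresentation.
Variables (F : fieldType) (p : nat) (gT : finGroupType) (G : {group gT}) (n : nat).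
Variable rG : mx_representation F G n.
Hypotheses (pF : p \in [pchar F]) (pG : (p.-group G)%g).

(** These are the vectors killed by the [m]-th power of the augmentation ideal. *)
Fixpoint rep_nilpotent m (v : 'rV[F]_n) : Prop :=
  if m is m'.+1 then forall g, g \in G -> rep_nilpotent m' (v *m rG g - v)
  else v = 0.

(** A [p]-group fixes a nonzero vector in the nonzero quotient by [U]. Adding a lift [u] of it to
    [U] raises the dimension and costs one more factor [g - 1]. *)
Lemma rep_nilpotent_flag d : (d <= n)%N -> exists (U : 'M[F]_n) m,
  [/\ mxmodule rG U, (d <= \rank U)%N &
      forall v : 'rV_n, (v <= U)%MS -> rep_nilpotent m v].
Proof.
elim: d => [_|d IH dn].
  exists 0, 0%N; split=> [||v]; rewrite ?mxmodule0 //.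
  by rewrite submx0 => /eqP.
have [U [m [Umod dU Um]]] := IH (ltnW dn).
have [ltdU|leUd] := ltnP d (\rank U); first by exists U, m.
have Ud : \rank U = d by apply/eqP; rewrite eqn_leq leUd.
have fix0 : rfix_mx (factmod_repr Umod) G != 0.
  apply: (rfix_pgroup_pchar pF) pG (subxx _).
  by rewrite mxrank_coker subn_gt0 Ud.
have /rowV0Pn[w wfix w0] := fix0.
have /rfix_mxP wG := wfix.
set u := val_factmod w.
have uU : ~~ (u <= U)%MS by rewrite -in_factmod_eq0 val_factmodK.
have uG g : g \in G -> (u *m rG g - u <= U)%MS.
  move=> gG; rewrite -in_factmod_eq0 linearB /= (in_factmodJ Umod) //.
  by rewrite val_factmodK [X in X - _](wG g gG) subrr.
exists (U + u)%MS, m.+1; split.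
- apply/mxmoduleP => g gG; rewrite addsmxMr addsmx_sub.
  rewrite (submx_trans _ (addsmxSl _ _)); last exact: (mxmoduleP Umod).
  rewrite -[u *m _](subrK u) addmx_sub ?addsmxSr //.
  by rewrite (submx_trans (uG g gG)) ?addsmxSl.
- rewrite -Ud; apply: rank_ltmx; rewrite /ltmx addsmxSl /=.
  by rewrite addsmx_sub submx_refl.
move=> v /sub_addsmxP[[v1 v2] /= ->] g gG; apply: Um.
rewrite mulmxDl opprD addrACA -(mulmxA v1) -(mulmxA v2) -!mulmxBr; apply: addmx_sub;
  apply: mulmx_sub.
  apply: addmx_sub; last by rewrite eqmx_opp.
  exact: (mxmoduleP Umod).
exact: uG.
Qed.

Lemma rep_nilpotentP : exists m, forall v, rep_nilpotent m v.
Proof.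
have [U [m [_ nU Um]]] := rep_nilpotent_flag (leqnn n).
exists m => v; apply: Um; apply: submx_full.
by rewrite row_full_unit -row_free_unit /row_free eqn_leq rank_leq_row.
Qed.

End UnipotentRepresentation.

(** [K m] stands for nilpotence of degree [m]. It is abstract so as to be instantiated with the
    nilpotence of functions lifted from a finite quotient to a profinite group. *)
Lemma group_functions_nilpotent (F : fieldType) (p : nat) (gT : finGroupType)
    (K : nat -> (gT -> F) -> Prop) :
  p \in [pchar F] -> (p.-group [set: gT])%g ->
  (forall f, (forall x, f x = 0) -> K 0%N f) ->
  (forall m f, (forall g, K m (fun x => f (g^-1 * x)%g - f x)) -> K m.+1 f) ->
  exists m, forall f, K m f.
Proof.
move=> pF pG K0 KS.
have [m mP] := rep_nilpotentP (regular_repr F [set: gT]%G) pF pG.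
(* The inverse turns left translation of functions into right multiplication, by which the regular
   representation acts. *)
pose vec (f : gT -> F) := \row_(i < gcard [set: gT]%G) f (enum_val i)^-1%g.
suff Kvec l f : rep_nilpotent (G :=
  [set: gT]%G) (regular_repr F [set: gT]%G) l (vec f) -> K l f.
  by exists m => f; apply: Kvec.
elim: l f => [f /= f0|l IH f /= fP].
  apply: K0 => x; have := congr1 (fun v : 'rV_(gcard [set: gT]) =>
    v 0 (gring_index [set: gT]%G x^-1%g)) f0.
  by rewrite !mxE gring_indexK ?inE // invgK.
apply: KS => g; apply: IH; have := fP g^-1%g (finset.in_setT _); congr rep_nilpotent.
apply/rowP => i; rewrite !mxE; congr (_ - _).
rewrite (bigD1 (gring_index [set: gT]%G (enum_val i * g)%g)) //= !mxE.
rewrite gring_indexK ?inE // mulgK gring_valK !eqxx mulr1 invMg.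
rewrite big1 ?addr0 // => j ji; rewrite !mxE /= [_ == _](_ : _ = false) ?mulr0 //.
apply: contra_neqF ji => /eqP ->.
by rewrite gring_indexK ?inE // mulgKV gring_valK.
Qed.

(** * Algebras with one quadratic relation *)

Section WeightFiltration.
Variables (k : fieldType) (A : algType k) (I : finType) (a b : I).
Variables (x r : I -> A).

Definition wt (i : I) : nat := if i == a then 2 else 3.

Lemma wtP i : (1 < wt i <= 3)%N. Proof. by rewrite /wt; case: ifP. Qed.

Lemma wt_a : wt a = 2%N. Proof. by rewrite /wt eqxx. Qed.

Lemma wt_neq i : i != a -> wt i = 3%N. Proof. by rewrite /wt => /negPf->. Qed.

(** A filtration by left ideals, where a right factor [x i] raises the weight by [wt i]. As the
    subtraction is truncated, nothing is asked of [u i] when [m <= wt i]. *)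
Inductive wfilt : nat -> A -> Prop :=
| Wfilt0 u : wfilt 0 u
| WfiltS m (u : I -> A) : (forall i, wfilt (m - wt i) (u i)) ->
    wfilt m (\sum_i u i * x i).

Lemma wfiltE m u : (0 < m)%N -> wfilt m u ->
  exists2 v : I -> A, forall i, wfilt (m - wt i) (v i) & u = \sum_i v i * x i.
Proof. by move=> m0 mu; case: mu m0 => // {}m v mv _; exists v. Qed.

Lemma wfilt_le m m' u : (m' <= m)%N -> wfilt m u -> wfilt m' u.
Proof.
move=> + mu; elim: mu m' => {m u} [u m'|m u _ IH m' m'm].
  by rewrite leqn0 => /eqP->; exact: Wfilt0.
by apply: WfiltS => i; apply: IH; exact: leq_sub2r.
Qed.

Lemma wfilt_0 m : wfilt m 0.
Proof.
elim/ltn_ind: m => -[|m] IH; first exact: Wfilt0.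
suff -> : 0 = \sum_i (fun=> 0) i * x i :> A.
  by apply: WfiltS => i; apply: IH; have := wtP i; lia.
by rewrite big1 // => i _; rewrite mul0r.
Qed.

Lemma wfiltD m u v : wfilt m u -> wfilt m v -> wfilt m (u + v).
Proof.
move=> mu; elim: mu v => {m u} [u v _|m u mu IH v]; first exact: Wfilt0.
case: (posnP m) => [->|m0 mv]; first by move=> _; exact: Wfilt0.
have [v' mv' ->] := wfiltE m0 mv.
rewrite -big_split /=; under eq_bigr do rewrite -mulrDl.
by apply: (@WfiltS m (fun i => u i + v' i)) => i; exact: IH.
Qed.

Lemma wfiltMl m u v : wfilt m u -> wfilt m (v * u).
Proof.
elim=> {m u} [u|m u _ IH]; first exact: Wfilt0.
rewrite mulr_sumr; under eq_bigr do rewrite mulrA.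
exact: (@WfiltS m (fun i => v * u i)).
Qed.

Lemma wfiltZ m c u : wfilt m u -> wfilt m (c *: u).
Proof. by move=> mu; rewrite -[u]mul1r scalerAl; exact: wfiltMl. Qed.

Lemma wfiltN m u : wfilt m u -> wfilt m (- u).
Proof. by rewrite -scaleN1r; exact: wfiltZ. Qed.

Lemma wfilt_sum m (T : Type) (s : seq T) (P : pred T) (F : T -> A) :
  (forall i, P i -> wfilt m (F i)) -> wfilt m (\sum_(i <- s | P i) F i).
Proof. by move=> mF; apply: big_ind => //; [exact: wfilt_0|exact: wfiltD]. Qed.

Lemma wfilt_trans m u v w : wfilt m (u - v) -> wfilt m (v - w) -> wfilt m (u - w).
Proof. by move=> uv /(wfiltD uv); rewrite addrA subrK. Qed.

Lemma wfilt_mulx m i u : wfilt m u -> wfilt (m + wt i) (u * x i).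
Proof.
move=> mu; have -> : u * x i = \sum_j (if j == i then u else 0) * x j.
  rewrite (bigD1 i) //= eqxx big1 ?addr0 // => j /negPf->; exact: mul0r.
apply: WfiltS => j; case: eqP => [->|_]; last exact: wfilt_0.
by rewrite addnK.
Qed.

Hypothesis aug : forall u, exists c (v : I -> A), u = c *: 1 + \sum_i v i * x i.

(** Expanding [v] by [aug] turns [u' i * x i * v] into a scalar multiple of [u' i * x i] plus left
    multiples of the [x j]. Their left factors [u' i * x i * w j] need only weight [m - wt j], which
    is covered by induction. *)
Lemma wfiltMr m u v : wfilt m u -> wfilt m (u * v).
Proof.
elim/ltn_ind: m u v => m IH u v mu.
have [->|m0] := posnP m; first exact: Wfilt0.
have [u' mu' ->] := wfiltE m0 mu; rewrite mulr_suml; apply: wfilt_sum => i _.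
have [c [w ->]] := aug v; rewrite mulrDr; apply: wfiltD.
  rewrite -scalerAr mulr1; apply: wfiltZ.
  by apply: wfilt_le (wfilt_mulx i (mu' i)); lia.
rewrite mulr_sumr; under eq_bigr do rewrite mulrA.
apply: (@WfiltS m (fun j => u' i * x i * w j)) => j.
apply: IH; first by have := wtP j; lia.
by apply: wfilt_le (wfilt_mulx i (mu' i)); lia.
Qed.

Lemma wfiltM s t u v : wfilt s u -> wfilt t v -> wfilt (s + t) (u * v).
Proof.
elim/ltn_ind: t u v => t IH u v su tv.
have [->|t0] := posnP t; first by rewrite addn0; exact: wfiltMr.
have [v' tv' ->] := wfiltE t0 tv; rewrite mulr_sumr.
under eq_bigr do rewrite mulrA.
apply: (@WfiltS (s + t) (fun j => u * v' j)) => i.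
have := IH (t - wt i)%N _ u (v' i) su (tv' i); have := wtP i => iP.
by move=> /(_ ltac:(lia)); apply: wfilt_le; lia.
Qed.

(* Words are written backwards: the head of the list is the rightmost factor. *)
Fixpoint ev (w : seq I) : A := if w is i :: u then ev u * x i else 1.

Definition weight (w : seq I) : nat := sumn [seq wt i | i <- w].

Lemma ev_cat u v : ev (v ++ u) = ev u * ev v.
Proof. by elim: v => [|i v IH] /=; rewrite ?mulr1 // IH mulrA. Qed.

Lemma weight_cat u v : weight (v ++ u) = (weight u + weight v)%N.
Proof. by rewrite /weight map_cat sumn_cat addnC. Qed.

Lemma wfilt_ev w : wfilt (weight w) (ev w).
Proof.
elim: w => [|i w IH]; first exact: Wfilt0.
by rewrite /= /weight /= addnC; exact: wfilt_mulx.
Qed.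

Fixpoint normal_word (w : seq I) : bool :=
  if w is i :: u then ~~ ((i == a) && (ohead u == Some b)) && normal_word u else true.

Definition letters_a (w : seq I) : nat := count_mem a w.
Arguments letters_a : simpl never.

(* Modulo [x b * x a ~ x a * x b], a word is determined by the number of its
   letters [a] and by the sequence of its other letters, where each letter other
   than [b] remembers the number of [a] to its left. *)
Fixpoint marks (w : seq I) : seq (I * nat) :=
  if w is i :: u then
    if i == a then marks u
    else (i, if i == b then 0%N else letters_a u) :: marks u
  else [::].

(** The effect on a mark of [e] more letters [a] on its left. The marks of [b] stay the same, since
    [x a] moves past [x b]. *)
Definition shift_mark e (y : I * nat) : I * nat :=
  (y.1, if y.1 == b then y.2 else (y.2 + e)%N).

Lemma shift_mark_inj e : injective (shift_mark e).
Proof.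
move=> [i m] [j n] /= [<-].
by case: ifP => _; [move=> ->|move=> /addIn ->].
Qed.

Lemma letters_a_cons i w : letters_a (i :: w) = ((i == a) + letters_a w)%N.
Proof. by []. Qed.

Lemma letters_a_cat u v : letters_a (v ++ u) = (letters_a u + letters_a v)%N.
Proof. by rewrite /letters_a count_cat addnC. Qed.

Lemma marks_cat u v :
  marks (v ++ u) = map (shift_mark (letters_a u)) (marks v) ++ marks u.
Proof.
elim: v => //= i v ->; case: ifP => //= _; congr (_ :: _).
rewrite /shift_mark /=; case: ifP => // _.
by rewrite letters_a_cat addnC.
Qed.

Lemma weight_marks w : weight w = (2 * letters_a w + 3 * size (marks w))%N.
Proof.
elim: w => //= i w; rewrite letters_a_cons /weight /wt /=.
by case: (i == a) => /=; lia.
Qed.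

Hypothesis ba : b != a.

(** This tells normal words ending with [x a] from words ending with another letter: there, the last
    mark belongs to [b] or counts all letters [a], whereas here it misses at least the final one. *)
Lemma normal_marks_head w i n y : normal_word (a :: w) ->
  marks w = (i, n) :: y -> i != b /\ (n <= letters_a w)%N.
Proof.
elim: w => //= j w IH; rewrite eqxx /= letters_a_cons.
have [->|ja] := eqVneq j a => /=.
  move=> /andP[_ /andP[h nw]] /IH[]; first by rewrite eqxx h.
  by move=> -> ?; split=> //; lia.
move=> /andP[/= jb _] [<- <- _]; split; first by apply: contraNneq jb => ->.
by case: ifP => // _; lia.
Qed.

(** The word is recovered letter by letter from the right. Whether the last letter is [a] can be
    seen from the marks by [normal_marks_head]. *)
Lemma marks_inj w w' : normal_word w -> normal_word w' ->
  letters_a w = letters_a w' -> marks w = marks w' -> w = w'.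
Proof.
elim: w w' => [|i w IH] [|j w'] //.
- by rewrite letters_a_cons /=; case: ifP.
- by rewrite letters_a_cons /=; case: ifP.
move=> niw njw'; have [nw nw'] : normal_word w /\ normal_word w'.
  by move: niw njw' => /= /andP[_ ->] /andP[_ ->].
have mixed u v l : normal_word (a :: u) -> l != a ->
    letters_a (a :: u) = letters_a (l :: v) -> marks u <> marks (l :: v).
  move=> nu la e /=; rewrite (negPf la) => /(normal_marks_head nu)[lb].
  by rewrite (negPf lb); move: e; rewrite !letters_a_cons eqxx (negPf la); lia.
have [ia|ia] := eqVneq i a; have [ja|ja] := eqVneq j a.
- subst i j; rewrite !letters_a_cons /= eqxx => /addnI e m.
  by congr (_ :: _); exact: IH.
- subst i => e; rewrite [marks (a :: w)]/= eqxx => m.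
  by case: (mixed w w' j).
- subst j => e; rewrite [marks (a :: w')]/= eqxx => /esym m.
  by case: (mixed w' w i).
rewrite !letters_a_cons /= (negPf ia) (negPf ja) => e [-> _ m].
by congr (_ :: _); exact: IH.
Qed.

Variables beta gamma : k.
Hypotheses (beta0 : beta != 0) (gamma0 : gamma != 0).
Hypothesis swap : wfilt 6 (beta *: (x b * x a) + gamma *: (x a * x b)).

(* [ev w] and [ev w'] have proportional classes in the associated graded ring. *)
Definition reduces w w' := exists z : k, [/\ normal_word w', z != 0,
  letters_a w' = letters_a w, marks w' = marks w &
  wfilt (weight w).+1 (ev w - z *: ev w')].

Lemma reduces_weight w w' : reduces w w' -> weight w' = weight w.
Proof. by move=> [z [_ _ e m _]]; rewrite !weight_marks e m. Qed.

Lemma reduces_cons i w w' : i != a -> reduces w w' -> reduces (i :: w) (i :: w').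
Proof.
move=> ia [z [nw' z0 e m zP]]; exists z; split=> //.
- by rewrite /= (negPf ia).
- by rewrite !letters_a_cons e.
- by rewrite /= (negPf ia) e m.
rewrite /= scalerAl -mulrBl; apply: wfilt_le (wfilt_mulx i zP).
by rewrite /weight /=; lia.
Qed.

(** The final [x a] moves to the left past the run of factors [x b] before it. By [swap], each
    exchange contributes a factor [- (gamma / beta)] and an error of higher weight. *)
Lemma reduces_a w : normal_word w -> exists w', reduces (a :: w) w'.
Proof.
elim: w => [|i w IH] nw.
  exists [:: a], 1; split; rewrite ?oner_eq0 //= ?andbF //.
  by rewrite scale1r subrr; exact: wfilt_0.
have [ib|ib] := eqVneq i b; last first.
  exists [:: a, i & w], 1; split; rewrite ?oner_eq0 //.
    by move: nw => /= ->; rewrite eqxx andbT /=; apply: contra_neqN ib => /eqP[].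
  by rewrite scale1r subrr; exact: wfilt_0.
subst i; have [w' [z [nw' z0 e m zP]]] := IH (proj2 (andP nw)).
exists (b :: w'), (- (gamma / beta) * z); split.
- by rewrite /= (negPf ba).
- by rewrite mulf_neq0 // oppr_eq0 mulf_neq0 // invr_eq0.
- by rewrite !letters_a_cons e letters_a_cons; lia.
- by rewrite /= (negPf ba) !eqxx m /= eqxx.
apply: (@wfilt_trans _ _ (- (gamma / beta) *: (ev w * x a * x b))).
  have -> : ev [:: a, b & w] - - (gamma / beta) *: (ev w * x a * x b) =
      ev w * (beta^-1 *: (beta *: (x b * x a) + gamma *: (x a * x b))).
    rewrite scalerDr !scalerA mulVf // scale1r mulrDr mulrA scaleNr opprK.
    by rewrite mulrC -scalerAr mulrA.
  apply: wfilt_le (wfiltM (wfilt_ev w) (wfiltZ _ swap)).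
  by rewrite /weight /= wt_a wt_neq //; lia.
rewrite -scalerA -scalerBr; apply: wfiltZ => /=.
rewrite scalerAl -mulrBl; apply: wfilt_le (wfilt_mulx b zP).
by rewrite /weight /= wt_a wt_neq //; lia.
Qed.

Lemma reducesP w : exists w', reduces w w'.
Proof.
elim: w => [|i w [u wu]].
  exists [::], 1; split; rewrite ?oner_eq0 //.
  by rewrite scale1r subrr; exact: wfilt_0.
have [->|ia] := eqVneq i a; last by exists (i :: u); exact: reduces_cons.
have [z [nu z0 e m zP]] := wu.
have [u' [z' [nu' z'0 e' m' zP']]] := reduces_a nu.
exists u', (z * z'); split=> //.
- by rewrite mulf_neq0.
- by rewrite e' !letters_a_cons e.
- by rewrite m' /= eqxx.
apply: (@wfilt_trans _ _ (z *: ev (a :: u))).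
  rewrite /= scalerAl -mulrBl; apply: wfilt_le (wfilt_mulx a zP).
  by rewrite /weight /=; lia.
rewrite -scalerA -scalerBr; apply: wfiltZ; apply: wfilt_le zP'.
by have := reduces_weight wu; rewrite /weight /=; lia.
Qed.

(** * Normal words span the associated graded ring *)

Fixpoint words (m : nat) : seq (seq I) :=
  match m with
  | 0 => [:: [::]]
  | 1 => [::]
  | 2 => [:: [:: a]]
  | (m'.+1 as m1).+2 =>
      [seq a :: u | u <- words m1] ++
      [seq i :: u | i <- enum (predC1 a), u <- words m']
  end.

Lemma weight_cons i w : weight (i :: w) = (wt i + weight w)%N.
Proof. by []. Qed.

Lemma mem_words m w : (w \in words m) = (weight w == m).
Proof.
elim/ltn_ind: m w => -[|[|[|m]]] IH w.
- by case: w => [|i w]; rewrite ?inE // weight_cons; have := wtP i; case: (wt i).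
- case: w => [|i w] //; rewrite weight_cons; have := wtP i.
  by case: (wt i) => [|[]].
- case: w => [|i w] //; rewrite inE weight_cons; apply/eqP/eqP.
    by move=> [-> ->]; rewrite wt_a.
  have := wtP i => iP e; have : wt i = 2%N by lia.
  rewrite /wt; have [->|//] := eqVneq i a; case: w e => // j w.
  by rewrite weight_cons; have := wtP j; lia.
rewrite -[words _]/([seq a :: u | u <- words m.+1] ++
      [seq i :: u | i <- enum (predC1 a), u <- words m]) mem_cat.
case: w => [|i w].
  rewrite [RHS](_ : _ = false) //; apply/norP; split; apply/negP.
    by case/mapP.
  by case/allpairsP => -[? ?] [].
rewrite weight_cons; have [->|ia] := eqVneq i a.
  rewrite wt_a mem_map => [|u v []//]; rewrite IH //.
  rewrite orb_idr; first by lia.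
  by case/allpairsP => -[j v] /= [+ _ [e _]]; rewrite mem_enum inE -e eqxx.
rewrite wt_neq // (_ : (_ \in _) = false) /=; last first.
  by apply/negP => /mapP[u _ [e _]]; rewrite e eqxx in ia.
have IHm := IH m ltac:(lia).
apply/allpairsP/idP => [[[j v] /= [_ + [_ ->]]]|wm].
  by rewrite IHm; lia.
by exists (i, w); rewrite mem_enum inE ia IHm; split=> //; lia.
Qed.

Lemma words_uniq m : uniq (words m).
Proof.
elim/ltn_ind: m => -[|[|[|m]]] IH //.
rewrite -[words _]/([seq a :: u | u <- words m.+1] ++
      [seq i :: u | i <- enum (predC1 a), u <- words m]) cat_uniq.
apply/and3P; split.
- by rewrite map_inj_uniq ?IH // => u v [].
- apply/hasPn => w /allpairsP[[j v] /= [+ _ ->]]; rewrite mem_enum inE => ja.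
  by apply/mapP => -[u _ [e _]]; rewrite e eqxx in ja.
- apply: allpairs_uniq; [exact: enum_uniq|by apply: IH; lia|].
  by move=> [i u] [j v] _ _ /= [-> ->].
Qed.

Definition comb m (c : seq I -> k) : A := \sum_(w <- words m) c w *: ev w.

Lemma comb_rec m (c : seq I -> k) : (0 < m)%N ->
  comb m c = \sum_(i | (wt i <= m)%N) comb (m - wt i) (fun u => c (i :: u)) * x i.
Proof.
have step i l c' : \sum_(u <- words l) c' (i :: u) *: ev (i :: u) =
    comb l (fun u => c' (i :: u)) * x i.
  by rewrite mulr_suml; apply: eq_bigr => u _; rewrite -scalerAl.
case: m => [//|[|[|m]]] _.
- rewrite /comb big_nil big_pred0 // => i; by have := wtP i; lia.
- rewrite /comb big_seq1 (big_pred1 a) => [|i]; last first.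
    by rewrite /wt /=; case: (i == a).
  by rewrite wt_a subnn big_seq1 -scalerAl.
rewrite /comb -[words m.+3]/([seq a :: u | u <- words m.+1] ++
      [seq i :: u | i <- enum (predC1 a), u <- words m]) big_cat big_map step /=.
rewrite (bigD1 a) ?wt_a //=; congr (_ + _).
rewrite big_allpairs_dep big_enum_cond; apply: eq_big => i.
  by rewrite inE andbT; have := wtP i; lia.
by rewrite inE andbT => ia; rewrite step wt_neq // !subSS subn0.
Qed.

Lemma combD m c d : comb m c + comb m d = comb m (fun w => c w + d w).
Proof. by rewrite /comb -big_split; apply: eq_bigr => w _; rewrite scalerDl. Qed.

Lemma combZ m z c : z *: comb m c = comb m (fun w => z * c w).
Proof. by rewrite /comb scaler_sumr; apply: eq_bigr => w _; rewrite scalerA. Qed.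

Lemma comb1 m w : weight w = m -> comb m (fun u => (u == w)%:R) = ev w.
Proof.
move=> wm; rewrite /comb (bigD1_seq w) ?words_uniq ?mem_words ?wm //= eqxx scale1r.
by rewrite big1 ?addr0 // => u /negPf->; rewrite scale0r.
Qed.

Lemma comb_eq0 m (c : seq I -> k) : (forall w, weight w = m -> c w = 0) ->
  comb m c = 0.
Proof.
move=> c0; rewrite /comb big_seq big1 // => w; rewrite mem_words => /eqP wm.
by rewrite c0 ?scale0r.
Qed.

Lemma wfilt_comb m c : wfilt m (comb m c).
Proof.
rewrite /comb big_seq; apply: wfilt_sum => w; rewrite mem_words => /eqP <-.
exact/wfiltZ/wfilt_ev.
Qed.

Definition normal_supp (c : seq I -> k) := forall w, c w != 0 -> normal_word w.

Definition spanned m u :=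
  exists2 c, normal_supp c & wfilt m.+1 (u - comb m c).

Lemma spannedD m u v : spanned m u -> spanned m v -> spanned m (u + v).
Proof.
move=> [c cn cP] [d dn dP]; exists (fun w => c w + d w).
  move=> w; apply: contraR => nw.
  by rewrite (contraNeq (@cn w) nw) (contraNeq (@dn w) nw) addr0.
by rewrite -combD opprD addrACA; exact: wfiltD.
Qed.

Lemma spannedZ m z u : spanned m u -> spanned m (z *: u).
Proof.
move=> [c cn cP]; exists (fun w => z * c w).
  by move=> w; rewrite mulf_eq0 negb_or => /andP[_ /cn].
by rewrite -combZ -scalerBr; exact: wfiltZ.
Qed.

Lemma spanned_high m u : wfilt m.+1 u -> spanned m u.
Proof.
move=> mu; exists (fun=> 0); first by move=> w; rewrite eqxx.
by rewrite comb_eq0 ?subr0.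
Qed.

Lemma spanned_sum m (T : Type) (s : seq T) (P : pred T) (F : T -> A) :
  (forall i, P i -> spanned m (F i)) -> spanned m (\sum_(i <- s | P i) F i).
Proof.
move=> sF; apply: big_ind => //; last exact: spannedD.
exact/spanned_high/wfilt_0.
Qed.

Lemma spanned_ev w : spanned (weight w) (ev w).
Proof.
have [w' ww'] := reducesP w; have wE := reduces_weight ww'.
have [z [nw' _ _ _ zP]] := ww'.
exists (fun u => z * (u == w')%:R); last by rewrite -combZ comb1.
by move=> u; have [->//|_] := eqVneq u w'; rewrite mulr0 eqxx.
Qed.

Lemma spanned_mulx m i u : spanned m u -> spanned (m + wt i) (u * x i).
Proof.
move=> [c _ cP]; rewrite -[u](subrK (comb m c)) mulrDl; apply: spannedD.
  by apply: spanned_high; apply: wfilt_le (wfilt_mulx i cP); lia.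
rewrite /comb mulr_suml big_seq; apply: spanned_sum => w.
rewrite mem_words => /eqP <-; rewrite -scalerAl; apply: spannedZ.
by rewrite addnC; exact: (spanned_ev (i :: w)).
Qed.

(** By induction, the left factors [v i] are combinations of normal words up to higher weight.
    Appending [x i] gives words that reduce to normal ones. *)
Lemma wfilt_spanned m u : wfilt m u -> spanned m u.
Proof.
elim/ltn_ind: m u => m IH u mu; have [m0|m0] := posnP m.
  have [z [v uE]] := aug u; exists (fun w => z * (w == [::])%:R).
    by case=> // i w; rewrite mulr0 eqxx.
  rewrite m0 -combZ comb1 // uE addrC addKr.
  by apply: WfiltS => i; have := wtP i; case: (wt i) => // n _; exact: Wfilt0.
have [v mv ->] := wfiltE m0 mu; apply: spanned_sum => i _.
have iP := wtP i; have [im|im] := leqP (wt i) m.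
  rewrite -(subnK im); apply: spanned_mulx; apply: IH (mv i); lia.
(* Here [wt i > m], so that [v i * x i] has weight [m.+1] whatever [v i] is. *)
apply: spanned_high.
have -> : v i * x i = \sum_j (if j == i then v i else 0) * x j.
  by rewrite (bigD1 i) //= eqxx big1 ?addr0 // => j /negPf->; rewrite mul0r.
apply: WfiltS => j; case: eqP => [->|_]; last exact: wfilt_0.
by rewrite (_ : (_ - _)%N = 0%N); [exact: Wfilt0|lia].
Qed.

(** * Linear independence of the normal words *)

Hypothesis separated : forall u, (forall m, wfilt m u) -> u = 0.
Hypothesis syzygy : forall v : I -> A,
  \sum_i v i * x i = 0 -> exists mu, forall i, v i = mu * r i.
Hypothesis r_wfilt : forall i, wfilt 2 (r i).
Hypothesis ra_lead : wfilt 4 (r a - beta *: x b).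

(** Otherwise [1], being equal to all its powers, would have every weight. *)
Lemma one_not_wfilt : ~ wfilt 1 (1 : A).
Proof.
move=> one; suff /eqP : 1 = 0 :> A by rewrite oner_eq0.
apply: separated; elim=> [|m IH]; first exact: Wfilt0.
by rewrite -[1]mul1r -addn1; exact: wfiltM.
Qed.

Lemma wfilt_ra : wfilt 3 (r a).
Proof.
rewrite -(subrK (beta *: x b) (r a)); apply: wfiltD; first exact: wfilt_le ra_lead.
by apply: wfiltZ; rewrite -[x b]mul1r -(wt_neq ba);
  exact: (@wfilt_mulx 0 b 1 (Wfilt0 _)).
Qed.

Definition cons_b (g : seq I -> k) (w : seq I) : k :=
  if w is i :: u then if i == b then g u else 0 else 0.

Lemma normal_cons_b g : normal_supp g -> normal_supp (cons_b g).
Proof.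
move=> gn [|i u] /=; first by rewrite eqxx.
have [->|] := eqVneq i b; last by rewrite eqxx.
by move=> /gn ->; rewrite (negPf ba).
Qed.

Lemma comb_cons_b s g : comb s g * x b = comb (s + 3) (cons_b g).
Proof.
rewrite (@comb_rec (s + 3)) ?addn3 // (bigD1 b) /=; last by rewrite wt_neq.
rewrite big1 => [|i /andP[_ ib]]; last first.
  by rewrite comb_eq0 ?mul0r // => w _; rewrite /= (negPf ib).
rewrite addr0 wt_neq // !subSS subn0; congr (_ * _).
by apply: eq_bigr => w _; rewrite /= eqxx.
Qed.

(* A relation of weight [m] lifts to [sum_i (f i - l i) * x i = 0] with [l i] of
   higher weight, hence [f i - l i = mu * r i]. The coefficient at [a], where
   [r a] starts with [beta *: x b] but [f a] involves no word ending with [b],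
   shows that [mu] has weight at least [m - 4]. *)
Lemma normal_indep m c : normal_supp c -> wfilt m.+1 (comb m c) ->
  forall w, weight w = m -> c w = 0.
Proof.
elim/ltn_ind: m c => m IH c cn cm w wm; have [m0|m0] := posnP m.
  case: w wm => [_|i w]; last by rewrite weight_cons; have := wtP i; lia.
  apply/eqP/negP => /negP c0; apply: one_not_wfilt.
  move: cm; rewrite m0 /comb big_seq1 => /(wfiltZ (c [::])^-1).
  by rewrite scalerA mulVf // scale1r.
pose f i := if (wt i <= m)%N then comb (m - wt i) (fun u => c (i :: u)) else 0.
have fE : comb m c = \sum_i f i * x i.
  rewrite comb_rec // big_mkcond /=; apply: eq_bigr => i _; rewrite /f.
  by case: ifP => //; rewrite mul0r.
have [l lP lE] := wfiltE (ltn0Sn m) cm.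
have [mu muE] : exists mu, forall i, f i - l i = mu * r i.
  apply: syzygy; under eq_bigr do rewrite mulrBl.
  by rewrite sumrB -fE -lE subrr.
have cn' i : normal_supp (fun u => c (i :: u)) by move=> u /cn /= /andP[].
(* The weight of [mu] is raised one unit at a time, by showing that its part [comb s g] of weight
   [s] vanishes. *)
have muP s : (s <= m - 4)%N -> wfilt s mu.
  elim: s => [_|s IHs sm]; first exact: Wfilt0.
  have smu := IHs (ltnW sm); have [g gn gP] := wfilt_spanned smu.
  (* Compare the lowest terms in [f a = l a + mu * r a], where [r a] starts with [beta *: x b]. *)
  have fa : wfilt (s + 4) (f a - beta *: (comb s g * x b)).
    have -> : f a - beta *: (comb s g * x b) = l a + (mu - comb s g) * r a
        + comb s g * (r a - beta *: x b).
      rewrite mulrBl mulrBr -scalerAr -muE addrA; congr (_ - _).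
      by rewrite addrA subrK addrC subrK.
    apply: wfiltD; last exact: wfiltM (wfilt_comb _ _) ra_lead.
    apply: wfiltD; first by apply: wfilt_le (lP a); rewrite wt_a; lia.
    by apply: wfilt_le (wfiltM gP wfilt_ra); lia.
  suff g0 u : weight u = s -> g u = 0.
    by move: gP; rewrite (comb_eq0 g0) subr0.
  (* If [s + 5 < m], then [f a] itself has weight at least [s + 4], so that [comb s g * x b] has
     too, and the induction hypothesis applies to it. *)
  move=> us; have [sm5|sm5] := ltnP (s + 5) m.
    suff : cons_b (fun w => beta * g w) (b :: u) = 0.
      by rewrite /= eqxx => /eqP; rewrite mulf_eq0 (negPf beta0) => /eqP.
    apply: (IH (s + 3)%N); first by lia.
    - by apply: normal_cons_b => v; rewrite mulf_eq0 => /norP[_ /gn].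
    - rewrite -comb_cons_b -combZ -scalerAl.
      rewrite -[X in wfilt _ X](subrK (f a)).
      apply: wfiltD; last first.
        rewrite /f; case: ifP => _; last exact: wfilt_0.
        by apply: wfilt_le (wfilt_comb _ _); rewrite wt_a; lia.
      by rewrite -opprB -addnS; exact: wfiltN.
    - by rewrite weight_cons wt_neq // us addnC.
  (* Now [m = s + 5], and [f a] has the same weight [s + 3] as [comb s g * x b]. The two do not
     interfere: [c] vanishes on [[:: a, b & u]], which is not normal. *)
  have fE' : f a = comb (s + 3) (fun v => c (a :: v)).
    by rewrite /f wt_a (_ : 2 <= m)%N; [congr comb|]; lia.
  pose d v := c (a :: v) + - beta * cons_b g v.
  have dn : normal_supp d.
    move=> v; apply: contraR => nv.
    by rewrite /d (contraNeq (@cn' a v) nv) (contraNeq (@normal_cons_b _ gn v) nv)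
      mulr0 addr0.
  have : d (b :: u) = 0.
    apply: (IH (s + 3)%N) => //; first by lia.
      by rewrite -combD -combZ -comb_cons_b -fE' scaleNr -addnS.
    by rewrite weight_cons wt_neq // us addnC.
  rewrite /d /= eqxx (_ : c _ = 0); last first.
    by apply: contraTeq isT => /cn; rewrite /= !eqxx.
  by rewrite add0r => /eqP; rewrite mulf_eq0 oppr_eq0 (negPf beta0) => /eqP.
(* With [mu] of weight [m - 4], each [mu * r i] has weight above [m - wt i], as [r a] has weight 3
   and the other [r i] have weight 2. The induction hypothesis thus applies to the coefficient of
   each [x i]. *)
case: w wm => [|i w wm]; first by move=> wm; move: m0; rewrite -wm.
have im : (wt i <= m)%N by rewrite -wm weight_cons leq_addr.
have [iP mm] := (wtP i, muP _ (leqnn _)).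
apply: (IH (m - wt i)%N _ _ (cn' i)); first by lia.
  have -> : comb (m - wt i) (fun u => c (i :: u)) = l i + mu * r i.
    by rewrite -muE /f im addrC subrK.
  apply: wfiltD; first by apply: wfilt_le (lP i); lia.
  have [ia|ia] := eqVneq i a.
    by rewrite ia wt_a; apply: wfilt_le (wfiltM mm wfilt_ra); lia.
  by apply: wfilt_le (wfiltM mm (r_wfilt i)); rewrite wt_neq //; lia.
by rewrite -wm weight_cons addKn.
Qed.

(** * Leading words and the absence of zero-divisors *)

Lemma valuation u : u != 0 -> exists2 s, wfilt s u & ~ wfilt s.+1 u.
Proof.
move=> u0; apply: contrapT => nval; case/eqP: u0; apply: separated.
elim=> [|m IH]; first exact: Wfilt0.
by apply: contrapT => nm; apply: nval; exists m.
Qed.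

(** Among the words in the part of lowest weight, one with the largest number of letters [a] is
    chosen, which makes its contribution to a product identifiable. *)
Lemma leading_word u : u != 0 -> exists s c w0, [/\ wfilt s.+1 (u - comb s c),
  normal_supp c, weight w0 = s, c w0 != 0 &
  forall w, weight w = s -> c w != 0 -> (letters_a w <= letters_a w0)%N].
Proof.
move=> /valuation[s su nsu]; have [c cn cP] := wfilt_spanned su.
exists s, c; pose S := [seq w <- words s | c w != 0].
have : S != [::].
  apply: contra_notN nsu => /eqP S0; move: cP; rewrite comb_eq0 ?subr0 // => w ws.
  apply: contraTeq isT => cw; have : w \in S by rewrite mem_filter cw mem_words ws /=.
  by rewrite S0.
case SE : S => [//|w1 S'] _.
have w1S : w1 \in S by rewrite SE mem_head.
pose M := \max_(w <- S) letters_a w.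
have [w0 w0S w0M] : exists2 w0, w0 \in S & letters_a w0 = M.
  have : has (fun w => letters_a w == M) S; last by case/hasP => w wS /eqP; exists w.
  rewrite /M SE; elim: S' w1 {SE w1S} => [|w S' IH] w1.
    by rewrite big_seq1 /= eqxx.
  rewrite big_cons /=; case: leqP => h; last by rewrite eqxx.
  by have /= -> := IH w; rewrite orbT.
move: w0S; rewrite mem_filter mem_words => /andP[cw0 /eqP w0s].
exists w0; split=> // w ws cw; rewrite w0M.
by apply: (@leq_bigmax_seq _ _ xpredT letters_a) => //;
  rewrite mem_filter cw mem_words ws /=.
Qed.

(* As the weight is fixed, the number of letters [a] determines the number of
   marks, so the marks of a product split uniquely. *)
Lemma leading_word_unique u v u0 v0 :
  weight u = weight u0 -> weight v = weight v0 -> normal_word u -> normal_word v ->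
  normal_word u0 -> normal_word v0 ->
  (letters_a u <= letters_a u0)%N -> (letters_a v <= letters_a v0)%N ->
  letters_a (v ++ u) = letters_a (v0 ++ u0) -> marks (v ++ u) = marks (v0 ++ u0) ->
  u = u0 /\ v = v0.
Proof.
move=> wu wv nu nv nu0 nv0 lu lv; rewrite !letters_a_cat => ll.
have eu : letters_a u = letters_a u0 by lia.
have ev : letters_a v = letters_a v0 by lia.
have su : size (marks u) = size (marks u0).
  by have := weight_marks u; have := weight_marks u0; lia.
have sv : size (marks v) = size (marks v0).
  by have := weight_marks v; have := weight_marks v0; lia.
rewrite !marks_cat eu => /eqP; rewrite eqseq_cat ?size_map // => /andP[/eqP mv /eqP mu].
split; apply: marks_inj => //.
exact: inj_map (@shift_mark_inj _) _ _ mv.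
Qed.

(** If [u * v = 0], the product of the lowest parts has weight above [s + t]. Once it is rewritten
    in normal words, independence makes all its coefficients vanish, but the one at the normal form
    of [v0 ++ u0] is a product of nonzero scalars. *)
Theorem weighted_domain (u v : A) : u != 0 -> v != 0 -> u * v != 0.
Proof.
move=> /leading_word[s [c [u0 [cP cn u0s cu0 umax]]]].
move=> /leading_word[t [d [v0 [dP dn v0t dv0 vmax]]]].
have us : wfilt s u.
  by rewrite -(subrK (comb s c) u); apply: wfiltD (wfilt_comb _ _); exact: wfilt_le cP.
apply/eqP => uv0.
have prodP : wfilt (s + t).+1 (comb s c * comb t d).
  have -> : comb s c * comb t d =
      u * v - (u * (v - comb t d) + (u - comb s c) * comb t d).
    by rewrite mulrBr mulrBl addrA subrK opprB addrC subrK.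
  rewrite uv0 sub0r; apply: wfiltN; apply: wfiltD.
    by rewrite -addnS; exact: wfiltM.
  by rewrite -addSn; apply: wfiltM (wfilt_comb _ _).
have [nf nfP] := choice reducesP; have [z zP] := choice nfP.
(* [h] collects the products of words by their normal forms [nf]; [z] is the scalar produced by the
   reduction. *)
pose h w := \sum_(p <- [seq (p, q) | p <- words s, q <- words t] | nf (p.2 ++ p.1) == w)
  c p.1 * d p.2 * z (p.2 ++ p.1).
have hn : normal_supp h.
  move=> w; apply: contraR => nw; rewrite /h big1 // => p /eqP pw.
  by case: (zP (p.2 ++ p.1)) => + _ _ _ _; rewrite pw (negPf nw).
have hP : wfilt (s + t).+1 (comb (s + t) h).
  rewrite -(subrK (comb s c * comb t d) (comb (s + t) h)); apply: wfiltD => //.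
  rewrite -opprB; apply: wfiltN.
  have -> : comb (s + t) h =
      \sum_(p <- [seq (p, q) | p <- words s, q <- words t])
        (c p.1 * d p.2) *: (z (p.2 ++ p.1) *: ev (nf (p.2 ++ p.1))).
    rewrite /comb /h; under eq_bigr do rewrite scaler_suml.
    rewrite (exchange_big_dep xpredT) //= big_seq [RHS]big_seq.
    apply: eq_bigr => p /allpairsP[[q q'] /= [qs q't ->]] /=.
    rewrite big_mkcond (bigD1_seq (nf (q' ++ q))) ?words_uniq //=; last first.
      rewrite mem_words (reduces_weight (nfP _)) weight_cat.
      by move: qs q't; rewrite !mem_words => /eqP-> /eqP->.
    by rewrite eqxx scalerA big1 ?addr0 // => w; rewrite eq_sym => /negPf->.
  rewrite /comb mulr_suml; under eq_bigr do rewrite mulr_sumr.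
  rewrite big_allpairs /= -sumrB big_seq; apply: wfilt_sum => p ps.
  rewrite -sumrB big_seq; apply: wfilt_sum => q qt.
  rewrite -scalerAl -scalerAr (scalerA (c p)) -ev_cat -scalerBr; apply: wfiltZ.
  case: (zP (q ++ p)) => _ _ _ _; rewrite weight_cat.
  by move: ps qt; rewrite !mem_words => /eqP-> /eqP->.
have := normal_indep hn hP (w := nf (v0 ++ u0)).
rewrite (reduces_weight (nfP _)) weight_cat u0s v0t => /(_ erefl).
rewrite /h big_mkcond (bigD1_seq (u0, v0)) //=; first last.
- by apply: allpairs_uniq; rewrite ?words_uniq // => -[? ?] [].
- by apply/allpairsP; exists (u0, v0); rewrite !mem_words u0s v0t !eqxx.
(* No other pair with nonzero coefficients has this normal form, as it would have the same marks and
   the same number of letters [a]. *)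
rewrite eqxx big_seq_cond big1 ?addr0 => [/eqP|]; last first.
  move=> _ /andP[/allpairsP[[p q] /= [ps qt ->]] /=].
  case: ifP => // /eqP pq; apply: contraNeq;
    rewrite !mulf_eq0 !negb_or => /andP[/andP[cp dq] _].
  move: ps qt; rewrite !mem_words => /eqP ps /eqP qt.
  case: (zP (q ++ p)) => _ _ e1 m1 _; case: (zP (v0 ++ u0)) => _ _ e2 m2 _.
  have [||||||||||-> ->] := @leading_word_unique p q u0 v0;
    rewrite ?ps ?qt ?u0s ?v0t //.
  - exact: cn.
  - exact: dn.
  - exact: cn.
  - exact: dn.
  - exact: umax.
  - exact: vmax.
  - by rewrite -e1 pq e2.
  - by rewrite -m1 pq m2.
by case: (zP (v0 ++ u0)) => _ z0 _ _ _;
  rewrite !mulf_eq0 (negPf cu0) (negPf dv0) (negPf z0).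
Qed.

End WeightFiltration.

Local Open Scope classical_set_scope.
Local Open Scope ring_scope.

(** * Extension of linear functionals from subspaces *)

Section LinearExtension.
Variables (k : fieldType) (V : lmodType k).

(** The graph of a linear functional on a subspace. A graph can be given by means of preimages, and
    [linear_relation_fun] then says that the value does not depend on them. *)
Record linear_relation (R : V -> k -> Prop) : Prop := LinearRelation {
  linear_relation0 : R 0 0;
  linear_relationP : forall c u a v b,
    R u a -> R v b -> R (c *: u + v) (c * a + b);
  linear_relation_fun : forall a, R 0 a -> a = 0
}.

Lemma linear_relation_inj R u a b : linear_relation R -> R u a -> R u b -> a = b.
Proof.
move=> [R0 RP Rf] Ra Rb; apply/eqP; rewrite -subr_eq0; apply/eqP/Rf.
by have := RP (-1) _ _ _ _ Rb Ra; rewrite scaleN1r addNr mulN1r addrC.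
Qed.

Lemma linear_relation_scale R u a c : linear_relation R -> R u a -> R (c *: u) (c * a).
Proof.
by move=> [R0 RP _] Ra; have := RP c _ _ _ _ Ra R0; rewrite !addr0.
Qed.

Lemma linear_relation_extend (R : V -> k -> Prop) : linear_relation R ->
  exists phi : {scalar V}, forall v a, R v a -> phi v = a.
Proof.
move=> Rlin; pose P (S : set (V * k)) :=
  (forall v a, R v a -> S (v, a)) /\ linear_relation (fun v a => S (v, a)).
have [|S [PS' Smax]] := @Zorn_bigcup _ (fun S => S = set0 \/ P S).
  move=> FF FP tot; have [[S0 FS0 PS0]|noP] := pselect (exists2 S, FF S & P S);
    last first.
    left; rewrite -subset0 => -[v a] [S FS Sva].
    by case: (FP _ FS) => [S0|PS]; [rewrite S0 in Sva|case: noP; exists S].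
  have PF S x : FF S -> S x -> P S by move=> /FP[->|].
  right; split=> [v a Rva|]; first by exists S0 => //; apply PS0.1.
  split=> [|c u a v b [S FS Su] [T FT Tv]|a [S FS Sa]].
  - by exists S0 => //; exact: (linear_relation0 PS0.2).
  - have [ST|TS] := tot _ _ FS FT.
      by exists T => //; exact: (linear_relationP (PF _ _ FT Tv).2 c (ST _ Su) Tv).
    by exists S => //; exact: (linear_relationP (PF _ _ FS Su).2 c Su (TS _ Tv)).
  - exact: (linear_relation_fun (PF _ _ FS Sa).2 Sa).
have PR : P [set x | R x.1 x.2] by [].
have [RS Slin] : P S.
  case: PS' => // S0; case: (Smax [set x | R x.1 x.2]); last by right.
  rewrite S0; split=> [|sub]; first exact: sub0set.
  exact: (sub (0, 0) (linear_relation0 Rlin)).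
have total v : exists a, S (v, a).
  apply: contrapT => nv.
  (* [T] extends the functional to [v] by the value [0]. *)
  pose T : set (V * k) := [set x | exists w a c, S (w, a) /\ x = (w + c *: v, a)].
  have ST : S `<` T.
    split=> [[w a] Swa|/(_ (v, 0)) TS]; first by exists w, a, 0; rewrite scale0r addr0.
    apply: nv; exists 0; apply: TS; exists 0, 0, 1; split;
      last by rewrite scale1r add0r.
    exact: (linear_relation0 Slin).
  case: (Smax _ ST); right; split=> [w a Rwa|]; first exact/ST.1/RS.
  split=> [|c _ _ _ _ [w [a [d [Sw [-> ->]]]]] [w' [a' [d' [Sw' [-> ->]]]]]|b [w [a
    [c [Sw [e ->]]]]]].
  - exact/ST.1/(linear_relation0 Slin).
  - exists (c *: w + w'), (c * a + a'), (c * d + d'); split.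
      exact: (linear_relationP Slin c Sw Sw').
    by rewrite scalerDr scalerA scalerDl addrACA.
  - have c0 : c = 0.
      apply/eqP; apply: contrapT => /negP c0; apply: nv; exists (- c^-1 * a).
      have -> : v = - c^-1 *: w.
        move/eqP: e; rewrite eq_sym addr_eq0 => /eqP ->.
        by rewrite scalerN scaleNr opprK scalerA mulVf // scale1r.
      exact: (linear_relation_scale _ Slin).
    by move: e Sw; rewrite c0 scale0r addr0 => <- /(linear_relation_fun Slin).
have [phi phiP] := choice total.
have phi_lin : scalar phi.
  move=> c u v; apply: (linear_relation_inj Slin (phiP _)).
  exact: (linear_relationP Slin c (phiP u) (phiP v)).
pose m := GRing.isLinear.Build _ _ _ _ phi phi_lin.
pose phi' : {scalar V} := HB.pack phi m.
by exists phi' => v a /RS; exact: (linear_relation_inj Slin (phiP v)).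
Qed.

End LinearExtension.

Lemma finite_groupType_finGroupType (Q : groupType) n :
  ([set: Q] #= `I_n)%card ->
  exists (gT : finGroupType) (phi : gT -> Q),
    [/\ bijective phi, {morph phi : x y / (x * y)%g} & #|gT| = n].
Proof.
move=> Qn.
have fQ : finite_set [set: Q] by exists n.
pose e : seq Q := fset_set [set: Q].
have ue : uniq e by exact: fset_uniq.
have eE x : x \in e by rewrite /e in_fset_set // in_setT.
pose h x : 'I_(size e) := Ordinal (etrans (index_mem x e) (eE x)).
pose h' (i : 'I_(size e)) : Q := nth 1%g e i.
have hK : cancel h h' by move=> x; rewrite /h' /= nth_index.
have h'K : cancel h' h by move=> i; apply: val_inj; rewrite /= index_uniq.
pose c : isCountable Q := CanIsCountable hK.
pose T : countType := HB.pack Q c.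
have finP : Finite.axiom (e : seq T) by move=> x; rewrite count_uniq_mem ?eE.
pose f := isFinite.Build T finP.
pose gT : finGroupType := HB.pack Q c f.
exists gT, id; split=> //; first by exists id.
have card : #|gT| = size e by rewrite cardE enumT unlock.
rewrite card.
have := Qn; have -> : [set: Q] = [set` fset_set [set: Q]] by rewrite fset_setK.
by move/card_eq_fsetP.
Qed.

(** * Operators on locally constant functions *)

Section CochainEvaluation.
Variables (F : fieldType) (X : topologicalType).
Implicit Types f g : cochain F X.

Definition cochain_eval (x : X) f : F^o := f x.

Lemma cochain_eval_linear x : linear (cochain_eval x).
Proof. by []. Qed.

HB.instance Definition _ x := GRing.isLinear.Build F (cochain F X) F^o _
  (cochain_eval x) (cochain_eval_linear x).

Lemma cochain0 x : (0 : cochain F X) x = 0. Proof. by []. Qed.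
Lemma cochainD f g x : cochain_fun (f + g) x = f x + g x. Proof. by []. Qed.
Lemma cochainB f g x : cochain_fun (f - g) x = f x - g x. Proof. by []. Qed.
Lemma cochainN f x : cochain_fun (- f) x = - f x. Proof. by []. Qed.
Lemma cochainZ c f x : cochain_fun (c *: f) x = c * f x. Proof. by []. Qed.

Lemma cochain_sum I (s : seq I) (P : pred I) (E : I -> cochain F X) x :
  cochain_fun (\sum_(i <- s | P i) E i) x = \sum_(i <- s | P i) E i x.
Proof. exact: (raddf_sum (cochain_eval x)). Qed.

Lemma cst_cochain_pred (c : F) : (fun=> c : F^o) \in cochain_pred F X.
Proof. by apply/cochain_predP => x; near=> y. Unshelve. all: by end_near. Qed.

Definition cst_cochain (c : F) : cochain F X :=
  Sub (fun=> c : F^o) (cst_cochain_pred c).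

Lemma cst_cochainE c x : cst_cochain c x = c. Proof. by []. Qed.

Lemma cst_cochainZ c : cst_cochain c = c *: cst_cochain 1.
Proof. by apply: cochainP => x; rewrite cochainZ !cst_cochainE mulr1. Qed.

End CochainEvaluation.

Section Translation.
Variables (F : fieldType) (G : topologicalGroupType).
Local Notation C := (cochain F G).
Implicit Types (f : C) (g x y : G).

Lemma continuous_mull g : continuous (fun x => g * x)%g.
Proof.
by apply: continuous_mul => x; [exact: cvg_cst|exact: cvg_id].
Qed.

Lemma translate_cochain g f : (fun x => f (g^-1 * x)%g : F^o) \in cochain_pred F G.
Proof. by apply: (cochain_comp f); exact: continuous_mull. Qed.

Definition translate g f : C :=
  Sub (fun x => f (g^-1 * x)%g : F^o) (translate_cochain g f).

Lemma translateE g f x : translate g f x = f (g^-1 * x)%g. Proof. by []. Qed.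

Lemma translate_linear g : linear (translate g).
Proof. by move=> c f f'; exact: cochainP. Qed.

HB.instance Definition _ g :=
  GRing.isLinear.Build F C C _ (translate g) (translate_linear g).

Lemma translate1 f : translate 1%g f = f.
Proof. by apply: cochainP => x; rewrite translateE invg1 mul1g. Qed.

Lemma translateM g h f : translate (g * h)%g f = translate g (translate h f).
Proof. by apply: cochainP => x; rewrite !translateE invgM mulgA. Qed.

Lemma translate_cst g c : translate g (cst_cochain G c) = cst_cochain G c.
Proof. exact: cochainP. Qed.

Lemma translate_fixed f : (forall g, translate g f = f) -> f = cst_cochain G (f 1%g).
Proof.
move=> fix_f; apply: cochainP => x.
by rewrite -{1}(fix_f x) translateE mulVg.
Qed.

(** The difference [f (x * z) - f z] does not depend on [z]; compare [z = y] with [z = 1]. *)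
Lemma translate_additive f : (forall g, exists c,
  translate g f - f = cst_cochain G c) ->
  forall x y, (f - cst_cochain G (f 1%g) : C) (x * y)%g =
    (f - cst_cochain G (f 1%g) : C) x + (f - cst_cochain G (f 1%g) : C) y.
Proof.
move=> fP x y; have [c cP] := fP x^-1%g.
have c_eq z : f (x * z)%g - f z = c.
  by have := congr1 (fun h : C => h z) cP; rewrite cochainB translateE invgK.
have /eqP := c_eq y; rewrite -(c_eq 1%g) mulg1 !cochainB !cst_cochainE subr_eq =>
  /eqP ->.
ring.
Qed.

Definition equivariant_pred : {pred C -> C} := fun T =>
  `[< linear T /\ forall g f, T (translate g f) = translate g (T f) >].

Lemma equivariant_submod : subsemimod_closed equivariant_pred.
Proof.
split; first split.
- apply/asboolP; split=> [c f f'|g f].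
    by rewrite -[RHS]/(c *: 0 + 0) scaler0 addr0.
  by rewrite -[RHS]/(translate g 0) linear0.
- move=> S T /asboolP[Sl Sg] /asboolP[Tl Tg]; apply/asboolP; split=> [c f f'|g f].
    by rewrite !fctE Sl Tl scalerDr addrACA.
  by rewrite !fctE Sg Tg linearD.
move=> c T /asboolP[Tl Tg]; apply/asboolP; split=> [d f f'|g f].
  by rewrite !fctE Tl scalerDr !scalerA mulrC.
by rewrite !fctE Tg linearZ.
Qed.

HB.instance Definition _ :=
  GRing.isSubmodClosed.Build F (C -> C) equivariant_pred equivariant_submod.

(* The [F]-algebra [F[[G]]], realized as the algebra of linear operators on the
   locally constant functions that commute with the left translations. *)
Definition operator := {T : C -> C | T \in equivariant_pred}.

HB.instance Definition _ := [isSub of operator for @sval _ _].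
HB.instance Definition _ := [Choice of operator by <:].
HB.instance Definition _ := [SubChoice_isSubLmodule of operator by <:].

Definition operator_fun (T : operator) : C -> C := val T.
Coercion operator_fun : operator >-> Funclass.
Implicit Types S T U : operator.

Lemma operatorP S T : S =1 T -> S = T.
Proof. by move=> ST; apply/val_inj/funext. Qed.

Lemma operator_linear T : linear T. Proof. by have /asboolP[] := valP T. Qed.

HB.instance Definition _ T :=
  GRing.isLinear.Build F C C _ (operator_fun T) (operator_linear T).

Lemma operator_translate T g f : T (translate g f) = translate g (T f).
Proof. by have /asboolP[] := valP T. Qed.

Lemma operator_one_pred : id \in equivariant_pred.
Proof. exact/asboolP. Qed.

Definition operator_one : operator := Sub (id : C -> C) operator_one_pred.

Lemma operator_mul_pred S T : S \o T \in equivariant_pred.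
Proof.
apply/asboolP; split=> [c f f'|g f] /=; first by rewrite !linearP.
by rewrite !operator_translate.
Qed.

Definition operator_mul S T : operator := Sub (S \o T) (operator_mul_pred S T).

Let mulA : associative operator_mul.
Proof. by move=> S T U; apply: operatorP => f. Qed.
Let mul1 : left_id operator_one operator_mul. Proof. by move=> S; exact: operatorP. Qed.
Let mulr1 : right_id operator_one operator_mul.
Proof. by move=> S; exact: operatorP. Qed.
Let mulDl : left_distributive operator_mul +%R.
Proof. by move=> S T U; exact: operatorP. Qed.
Let mulDr : right_distributive operator_mul +%R.
Proof. by move=> S T U; apply: operatorP => f; exact: (linearD S). Qed.
Let one_neq0 : operator_one != 0.
Proof.
apply/eqP => /(congr1 (fun T : operator => T (cst_cochain G 1) 1%g)) /eqP.
by rewrite [X in X == _]/= oner_eq0.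
Qed.

HB.instance Definition _ := GRing.Zmodule_isNzRing.Build operator
  mulA mul1 mulr1 mulDl mulDr one_neq0.

Let scaleAl c S T : c *: (S * T) = (c *: S) * T. Proof. exact: operatorP. Qed.
Let scaleAr c S T : c *: (S * T) = S * (c *: T).
Proof. by apply: operatorP => f; exact: esym (linearZ_LR S c (T f)). Qed.

HB.instance Definition _ := GRing.Lmodule_isLalgebra.Build F operator scaleAl.
HB.instance Definition _ := GRing.Lalgebra_isAlgebra.Build F operator scaleAr.

Lemma operatorM S T f : operator_fun (S * T) f = S (T f). Proof. by []. Qed.
Lemma operator1 f : (1 : operator) f = f. Proof. by []. Qed.
Lemma operator0 f : (0 : operator) f = 0. Proof. by []. Qed.
Lemma operatorD S T f : operator_fun (S + T) f = S f + T f. Proof. by []. Qed.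
Lemma operatorB S T f : operator_fun (S - T) f = S f - T f. Proof. by []. Qed.
Lemma operatorZ c T f : operator_fun (c *: T) f = c *: T f. Proof. by []. Qed.

Lemma operator_sum I (s : seq I) (P : pred I) (E : I -> operator) f :
  operator_fun (\sum_(i <- s | P i) E i) f = \sum_(i <- s | P i) E i f.
Proof. by elim/big_rec2: _ => // i _ y _ <-. Qed.

(** By equivariance, an operator is determined by the functional [f |-> T f 1]. This and
    [functional_operator] identify the operators with the dual of [C]. *)
Lemma operatorE T f x : T f x = T (translate x^-1%g f) 1%g.
Proof. by rewrite operator_translate translateE invgK mulg1. Qed.

Lemma operator_ext S T : (forall f, S f 1%g = T f 1%g) -> S = T.
Proof.
by move=> ST; apply: operatorP => f; apply: cochainP => x;
  rewrite operatorE ST -operatorE.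
Qed.

End Translation.

Section CompactGroup.
Variables (F : fieldType) (G : topologicalGroupType).
Local Notation C := (cochain F G).
Implicit Types (f : C) (g x y : G).
Hypothesis compactG : compact [set: G].

(** The elements that can be inserted anywhere without changing [f] form a normal subgroup, because
    both sides [x] and [y] vary. It is open by compactness of [G * G], as in the tube lemma. *)
Lemma cochain_invariant f : exists N : openNormalSubgroup G,
  forall x n y, normal_set N n -> f (x * n * y)%g = f (x * y)%g.
Proof.
pose A : set G := [set n | forall x y, f (x * n * y)%g = f (x * y)%g].
have A1 : A 1%g by move=> x y; rewrite mulg1.
have AM x y : A x -> A y -> A (x * y)%g.
  by move=> Ax Ay u v; rewrite mulgA Ay Ax.
have AV x : A x -> A x^-1%g.
  by move=> Ax u v; rewrite -(Ax (u * x^-1)%g) mulgKV.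
have AJ x y : A x -> A (x ^ y)%g.
  by move=> Ax u v; rewrite /conjg !mulgA -(mulgA _ y v) Ax mulgA mulgKV.
pose N := NormalSubgroup A1 AM AV AJ.
suff oA : open (N : set G).
  by exists (OpenNormalSubgroup oA) => x n y /= An; exact: An.
rewrite openE => n An; rewrite /interior /=.
have cGG : compact [set: G * G] by rewrite -setXTT; exact: compact_setX.
have /compact_near_coveringP cov := cGG.
pose P (i : G) (xy : G * G) := f (xy.1 * i * xy.2)%g = f (xy.1 * n * xy.2)%g.
have cont : continuous (fun xyi : G * G * G => (xyi.1.1 * xyi.2 * xyi.1.2)%g).
  apply: continuous_mul; last first.
    by move=> z; apply: continuous_comp; [exact: cvg_fst|exact: cvg_snd].
  apply: continuous_mul; last by move=> z; exact: cvg_snd.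
  by move=> z; apply: continuous_comp; [exact: cvg_fst|exact: cvg_fst].
have contn : continuous (fun xyi : G * G * G => (xyi.1.1 * n * xyi.1.2)%g).
  apply: continuous_mul; last first.
    by move=> z; apply: continuous_comp; [exact: cvg_fst|exact: cvg_snd].
  apply: continuous_mul; last by move=> z; exact: cvg_cst.
  by move=> z; apply: continuous_comp; [exact: cvg_fst|exact: cvg_fst].
have near_n : \forall i \near n, [set: G * G] `<=` P i.
  apply: cov => -[x y] _.
  have h1 : \forall t \near (x, y, n), f (t.1.1 * t.2 * t.1.2)%g = f (x * n * y)%g.
    exact: cont (x, y, n) _ (cochain_near f (x * n * y)%g).
  have h2 : \forall t \near (x, y, n), f (t.1.1 * n * t.1.2)%g = f (x * n * y)%g.
    exact: contn (x, y, n) _ (cochain_near f (x * n * y)%g).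
  by apply: filterS2 h1 h2 => -[[x' y'] i] /= e1 e2; rewrite /P /= e1 e2.
by apply: filterS near_n => i Pi x y; rewrite (Pi (x, y) I) An.
Qed.

Definition right_invariant (N : set G) f := forall x n, N n -> f (x * n)%g = f x.

Lemma cochain_right_invariant f :
  exists N : openNormalSubgroup G, right_invariant N f.
Proof.
have [N fN] := cochain_invariant f; exists N => x n Nn.
by rewrite -[(x * n)%g]mulg1 fN // mulg1.
Qed.

Lemma right_invariant_translate N g f :
  right_invariant N f -> right_invariant N (translate g f).
Proof. by move=> fN x n Nn; rewrite !translateE mulgA fN. Qed.

Lemma right_invariant_coset (N : normalSubgroup G) f x y :
  right_invariant N f -> coset N x = coset N y -> f x = f y.
Proof. by move=> fN /coset_eqP /(fN x) <-; rewrite mulKVg. Qed.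

Lemma open_subgroup_near (N : openNormalSubgroup G) g :
  \forall h \near g, normal_set N (g^-1 * h)%g.
Proof.
have := @continuous_mull G g^-1%g g; apply.
rewrite mulVg; apply: open_nbhs_nbhs; split; first exact: openNormal_open.
exact: normal1.
Qed.

Lemma invariant_cochain (N : openNormalSubgroup G) (h : G -> F) :
  (forall x n, normal_set N n -> h (x * n)%g = h x) ->
  (h : G -> F^o) \in cochain_pred F G.
Proof.
move=> hN; apply/cochain_predP => x.
by apply: filterS (open_subgroup_near N x) => y /(hN x); rewrite mulKVg.
Qed.

Lemma translate_near f g : \forall h \near g, translate h f = translate g f.
Proof.
have [N fN] := cochain_invariant f.
have near_inv : \forall h \near g, normal_set N (g^-1^-1 * h^-1)%g.
  exact: @invg_continuous G g _ (open_subgroup_near N g^-1%g).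
apply: filterS near_inv => h /= Nh; apply: cochainP => x; rewrite !translateE.
by rewrite -(fN g^-1%g _ x Nh) mulKVg.
Qed.

(** Equivariance forces [T f x = phi (translate x^-1 f)], which is locally constant in [x] because
    [translate x^-1 f] is. *)
Lemma functional_operator (phi : {scalar C}) :
  exists T : operator F G, forall f, T f 1%g = phi f.
Proof.
have Tc f : (fun x => phi (translate x^-1%g f) : F^o) \in cochain_pred F G.
  apply/cochain_predP => x.
  have h : \forall y \near x, translate y^-1%g f = translate x^-1%g f.
    exact: @invg_continuous G x _ (translate_near f x^-1%g).
  by apply: filterS h => y /= ->.
pose T f : C := Sub (fun x => phi (translate x^-1%g f) : F^o) (Tc f).
have TE f x : T f x = phi (translate x^-1%g f) by [].
have Tp : T \in @equivariant_pred F G.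
  apply/asboolP; split=> [c f f'|g f]; apply: cochainP => x.
    by rewrite cochainDZ !TE !linearP.
  by rewrite translateE !TE -translateM invgM invgK.
exists (Sub T Tp : operator F G) => f.
by rewrite /operator_fun /= TE invg1 translate1.
Qed.

End CompactGroup.

(** * The pairing of a group algebra with functions on the group *)

Section AlgebraPairing.
Variables (F : fieldType) (Q : groupType).
Implicit Types (u v : groupAlgebra F Q) (h : Q -> F).

Definition ga_pair h u : F := ga_ext (fun q r => r * h q) u.

Lemma ga_pair0 h : ga_pair h 0 = 0. Proof. by apply: ga_ext0 => q; exact: mul0r. Qed.

Lemma ga_pairD h u v : ga_pair h (u + v) = ga_pair h u + ga_pair h v.
Proof. by apply: ga_extD => [q|q r s]; [exact: mul0r|exact: mulrDl]. Qed.

Lemma ga_pair_monomial h q r : ga_pair h (monomial q r) = r * h q.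
Proof.
by apply: (ga_ext_monomial (V := F) (F := fun q r => r * h q)) => x; exact: mul0r.
Qed.

Lemma ga_pairM h u v :
  ga_pair h (u * v) = ga_pair (fun q => ga_pair (fun q' => h (q * q')%g) v) u.
Proof.
elim/ga_ind: u => [q r||u u' IH IH'].
- rewrite ga_pair_monomial; elim/ga_ind: v => [q' r'||v v' IH IH'].
  + by rewrite monomialM !ga_pair_monomial mulrA.
  + by rewrite mulr0 !ga_pair0 mulr0.
  + by rewrite mulrDr !ga_pairD mulrDr IH IH'.
- by rewrite mul0r !ga_pair0.
- by rewrite mulrDl !ga_pairD IH IH'.
Qed.

Lemma ga_pair_linear c h h' u :
  ga_pair (fun q => c * h q + h' q) u = c * ga_pair h u + ga_pair h' u.
Proof.
rewrite /ga_pair /ga_ext mulr_sumr -big_split; apply: eq_bigr => q _ /=; ring.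
Qed.

Lemma ga_pair_delta q u : ga_pair (fun x => (x == q)%:R) u = u q.
Proof.
elim/ga_ind: u => [q' r||u u' IH IH'].
- rewrite ga_pair_monomial monomialE eq_sym.
  by case: eqP => _; rewrite ?mulr1 ?mulr0.
- by rewrite ga_pair0 ga0.
- by rewrite ga_pairD gaD IH IH'.
Qed.

End AlgebraPairing.

Lemma ga_pair_map (F : fieldType) (Q Q' : groupType) (phi : Q -> Q') (h : Q' -> F)
    (u : groupAlgebra F Q) :
  ga_pair h (ga_map phi u) = ga_pair (h \o phi) u.
Proof.
elim/ga_ind: u => [q r||u u' IH IH'].
- by rewrite ga_map_monomial !ga_pair_monomial.
- by rewrite raddf0 !ga_pair0.
- by rewrite raddfD !ga_pairD IH IH'.
Qed.

(** * The completed group algebra as an algebra of operators *)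

Section CompletedAlgebraOperators.
Variables (F : fieldType) (G : topologicalGroupType).
Local Notation C := (cochain F G).
Local Notation A := (completedGroupAlgebra F G).
Hypothesis compactG : compact [set: G].

(** Evaluation at representatives is meaningful for functions [f] that are right invariant under
    [N]; for these the value does not depend on [N], see [cga_pair_indep]. *)
Definition cga_pair (a : A) (N : openNormalSubgroup G) (f : C) : F :=
  ga_pair (fun q : quotientGroup N => f (repr q)) (a N).

Lemma cga_pair_sub a (N M : openNormalSubgroup G) f : (N : set G) `<=` M ->
  right_invariant M f -> cga_pair a N f = cga_pair a M f.
Proof.
move=> NM fM; rewrite /cga_pair -(cga_coherent a NM) ga_pair_map.
congr ga_pair; apply: funext => q /=; apply: right_invariant_coset fM _.
by rewrite coset_repr.
Qed.

Lemma openNormalI (N M : openNormalSubgroup G) :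
  exists K : openNormalSubgroup G, (K : set G) `<=` N /\ (K : set G) `<=` M.
Proof.
pose S := (N : set G) `&` (M : set G).
have S1 : S 1%g by split; exact: Defs.normal1.
have SM x y : S x -> S y -> S (x * y)%g.
  by move=> [? ?] [? ?]; split; exact: Defs.normalM.
have SV x : S x -> S x^-1%g by move=> [? ?]; split; exact: normalV.
have SJ x y : S x -> S (x ^ y)%g by move=> [? ?]; split; exact: Defs.normalJ.
have oS : open S by apply: openI; exact: openNormal_open.
by exists (@OpenNormalSubgroup G (NormalSubgroup S1 SM SV SJ) oS); split=> x [].
Qed.

Lemma cga_pair_indep a (N M : openNormalSubgroup G) f :
  right_invariant N f -> right_invariant M f -> cga_pair a N f = cga_pair a M f.
Proof.
move=> fN fM; have [K [KN KM]] := openNormalI N M.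
by rewrite -(cga_pair_sub a KN fN) (cga_pair_sub a KM fM).
Qed.

Lemma cga_operator_exists (a : A) : exists T : operator F G,
  forall N f, right_invariant (normal_set (openNormal_normal N)) f ->
    T f 1%g = cga_pair a N f.
Proof.
have [N NP] := choice (@cochain_right_invariant F G compactG).
pose phi (f : C) : F^o := cga_pair a (N f) f.
have phiE M f : right_invariant (normal_set (openNormal_normal M)) f ->
  phi f = cga_pair a M f by move=> fM; exact: cga_pair_indep.
have phi_lin : scalar phi.
  move=> c f f'; have [M [MN MN']] := openNormalI (N f) (N f').
  have fM : right_invariant M f by move=> x n nM; exact/NP/MN.
  have fM' : right_invariant M f' by move=> x n nM; exact/NP/MN'.
  rewrite (phiE M) => [|x n nM]; last by rewrite !cochainDZ fM // fM'.
  by rewrite (phiE M f) // (phiE M f') // -ga_pair_linear.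
pose m := GRing.isLinear.Build _ _ _ _ phi phi_lin.
pose phi' : {scalar C} := HB.pack phi m.
have [T TE] := functional_operator compactG phi'.
by exists T => M f fM; rewrite TE; exact: phiE.
Qed.

(** The map [op] from the completed group algebra to the operators is multiplicative and sends
    nonzero elements to nonzero operators. *)
Lemma cga_domain :
  (forall S T : operator F G, S != 0 -> T != 0 -> S * T != 0) ->
  forall a b : A, a != 0 -> b != 0 -> a * b != 0.
Proof.
move=> dom a b; have [op opE] := choice cga_operator_exists.
have op_neq0 (c : A) : c != 0 -> op c != 0.
  move=> c0; have [N cN] : exists N, c N <> 0.
    apply: contrapT => noN; case/eqP: c0; apply: cgaP => N.
    by apply: contrapT => cN; apply: noN; exists N.
  have [q cq] : exists q, c N q <> 0.
    apply: contrapT => noq; apply: cN; apply/fsfunP => q; rewrite ga0.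
    by apply: contrapT => cq; apply: noq; exists q.
  apply: contra_not_neq cq => op0.
  have fN x n : normal_set N n ->
      ((coset N (x * n) == q)%:R : F) = (coset N x == q)%:R.
    move=> Nn; congr (_ == _)%:R; apply/coset_eqP.
    by rewrite invgM mulgKV; exact: normalV.
  (* Pairing with the indicator function of the coset [q] reads off the coefficient [c N q]. *)
  pose f : C := Sub (fun x => (coset N x == q)%:R : F^o) (invariant_cochain fN).
  have := opE c N f fN; rewrite op0 /cga_pair.
  have -> : (fun x : quotientGroup N => f (repr x)) = (fun x => (x == q)%:R).
    by apply: funext => x; rewrite -{2}(coset_repr x).
  by rewrite ga_pair_delta => <-.
(* The two-sided invariance of [f] is used to see that [op b f] is again right invariant under
   [N]. *)
have opM : op (a * b) = op a * op b.
  apply: operator_ext => f; have [N fN] := cochain_invariant compactG f.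
  have fN' : right_invariant N f by move=> x n Nn;
    rewrite -[(x * n)%g]mulg1 fN // mulg1.
  rewrite (opE _ N f fN') operatorM (opE _ N) => [|x n Nn]; last first.
    rewrite operatorE (operatorE _ _ x); congr (cochain_fun (op b _) _).
    by apply: cochainP => y; rewrite !translateE !invgK fN.
  rewrite /cga_pair cgaM ga_pairM; congr ga_pair; apply: funext => q.
  rewrite operatorE (opE _ N); last exact: right_invariant_translate.
  rewrite /cga_pair; congr ga_pair; apply: funext => q'; rewrite translateE invgK.
  by apply: right_invariant_coset fN' _; rewrite cosetM !coset_repr.
move=> /op_neq0 a0 /op_neq0 b0; apply: contra_neq (dom _ _ a0 b0) => ab0.
rewrite -opM ab0; apply: operator_ext => f.
have [N fN] := cochain_right_invariant compactG f.
by rewrite (opE _ N f fN) /cga_pair cga0 ga_pair0.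
Qed.

End CompletedAlgebraOperators.

(** * The minimal resolution of a Demushkin group *)

Section Nilpotence.
Variables (V : zmodType) (I : Type) (act : I -> V -> V).

Fixpoint nilpotent_at m (v : V) : Prop :=
  if m is m'.+1 then forall g, nilpotent_at m' (act g v - v) else v = 0.

(* The substitute for the existence of fixed points of a [p]-group acting on the
   quotient of [P] by [W]. *)
Lemma nilpotent_fixed_vector (P W : V -> Prop) m v :
  (forall g u, P u -> P (act g u - u)) -> W 0 -> nilpotent_at m v -> P v -> ~ W v ->
  exists u, [/\ P u, ~ W u & forall g, W (act g u - u)].
Proof.
move=> PS W0; elim: m v => [_ -> //|m IH v vm Pv Wv].
have [all|/existsNP[g gW]] := pselect (forall g, W (act g v - v)); first by exists v.
exact: IH (vm g) (PS g v Pv) gW.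
Qed.

End Nilpotence.

Section ProPGroup.
Variables (F : fieldType) (p : nat) (G : topologicalGroupType).
Hypotheses (pF : p \in [pchar F]) (G_pro_p : pro_p_group p G).
Local Notation C := (cochain F G).
Local Notation translate := (@translate F G).
Local Notation cst := (@cst_cochain F G).

Lemma pro_p_compact : compact [set: G]. Proof. by case: G_pro_p => -[]. Qed.

Lemma nilpotent_at_S m (f : C) : nilpotent_at translate m f ->
  nilpotent_at translate m.+1 f.
Proof.
elim: m f => [f /= -> g|m IH f fm g]; first by rewrite linear0 subr0.
exact: IH.
Qed.

Lemma nilpotent_at_le m m' (f : C) : (m <= m')%N ->
  nilpotent_at translate m f -> nilpotent_at translate m' f.
Proof.
by move=> /subnK <-; elim: (m' - m)%N => // d IH /IH; exact: nilpotent_at_S.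
Qed.

(** [f] factors through a finite quotient of [G], which is a [p]-group and hence acts unipotently on
    its functions. *)
Lemma cochain_nilpotent (f : C) : exists m, nilpotent_at translate m f.
Proof.
have [N fN] := cochain_right_invariant pro_p_compact f.
have [k Nk] := G_pro_p.2 N.
have [gT [phi [[psi phiK psiK] phiM card_gT]]] := finite_groupType_finGroupType Nk.
pose lift_fun (h : gT -> F) (x : G) : F := h (psi (coset N x)).
have lift_inv h x n : normal_set N n -> lift_fun h (x * n)%g = lift_fun h x.
  move=> Nn; congr (h (psi _)); apply/coset_eqP.
  by rewrite invgM mulgKV; exact: normalV.
pose lift h : C := Sub (lift_fun h : G -> F^o) (invariant_cochain (lift_inv h)).
have liftE h x : lift h x = h (psi (coset N x)) by [].
have [| | | |m mP] := @group_functions_nilpotent F p gT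
    (fun m h => nilpotent_at translate m (lift h)).
- exact: pF.
- by rewrite /pgroup cardsT card_gT pnatX pnat_id // (pcharf_prime pF).
- by move=> h h0; apply: cochainP => x; rewrite liftE h0.
- move=> m h hP g; have := hP (psi (coset N g)).
  congr nilpotent_at; apply: cochainP => x; rewrite cochainB translateE !liftE.
  congr (h _ - _); apply: (mulgI (psi (coset N g))); rewrite mulKVg.
  by apply: (can_inj phiK); rewrite phiM !psiK -cosetM mulKVg.
exists m; have := mP (fun t => f (repr (phi t))); congr nilpotent_at.
apply: cochainP => x; rewrite liftE; apply: right_invariant_coset fN _.
by rewrite coset_repr psiK.
Qed.

End ProPGroup.

Section DemushkinResolution.
Variables (F : fieldType) (p : nat) (G : topologicalGroupType).
Hypotheses (pF : p \in [pchar F]) (G_pro_p : pro_p_group p G).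
Local Notation C := (cochain F G).
Local Notation translate := (@translate F G).
Local Notation cst := (@cst_cochain F G).

Variables (n : nat) (chi : 'I_n -> C).
Hypothesis chi_hom : forall i x y, chi i (x * y)%g = chi i x + chi i y.
Hypothesis chi_span : forall f : C, (forall x y, f (x * y)%g = f x + f y) ->
  exists c : 'I_n -> F, f = \sum_i c i *: chi i.
Hypothesis chi_free : forall c : 'I_n -> F, \sum_i c i *: chi i = 0 ->
  forall i, c i = 0.

Let compactG : compact [set: G] := pro_p_compact G_pro_p.

Lemma chi1 i : chi i 1%g = 0.
Proof.
have /eqP := chi_hom i 1%g 1%g.
by rewrite mulg1 -subr_eq0 opprD addrA subrr add0r oppr_eq0 => /eqP.
Qed.

Lemma chiV i x : chi i x^-1%g = - chi i x.
Proof.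
by apply/eqP; rewrite -addr_eq0 -chi_hom mulVg chi1.
Qed.

Lemma translate_chi g i : translate g (chi i) = chi i - cst (chi i g).
Proof.
apply: cochainP => x; rewrite cochainB translateE chi_hom chiV.
by rewrite [RHS]addrC.
Qed.

(** The dual functional of [chi i] on the span of [1] and the [chi j] is extended to [C]. The
    operator that belongs to it sends [chi j] to a constant, as translations change [chi j] only by
    constants. *)
Lemma dual_operators : exists X : 'I_n -> operator F G,
  (forall i c, X i (cst c) = 0) /\
  (forall i j, X i (chi j) = cst (i == j)%:R).
Proof.
suff /choice[X XP] : forall i, exists X : operator F G,
    (forall c, X (cst c) = 0) /\ (forall j, X (chi j) = cst (i == j)%:R).
  by exists X; split=> i; case: (XP i).
move=> i; pose R (f : C) (c : F) := exists (d : F) (a : 'I_n -> F),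
  f = cst d + \sum_j a j *: chi j /\ c = a i.
have Rlin : linear_relation R.
  split=> [|c _ _ _ _ [d [a [-> ->]]] [d' [a' [-> ->]]]|_ [d [a [e ->]]]].
  - exists 0, (fun=> 0); rewrite big1 => [|j _]; last by rewrite scale0r.
    by split=> //; apply: cochainP => x; rewrite cochainD cst_cochainE addr0.
  - exists (c * d + d'), (fun j => c * a j + a' j); split=> //.
    rewrite scalerDr addrACA; congr (_ + _); first exact: cochainP.
    by rewrite scaler_sumr -big_split; apply: eq_bigr => j _;
      rewrite /= scalerDl scalerA.
  - have d0 : d = 0.
      have := congr1 (fun f : C => f 1%g) e.
      rewrite cochainD cst_cochainE cochain_sum big1 ?addr0 // => j _.
      by rewrite cochainZ chi1 mulr0.
    have cst0 : cst 0 = 0 by exact: cochainP.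
    by apply: chi_free; rewrite [RHS]e d0 cst0 add0r.
have [phi phiP] := linear_relation_extend Rlin.
have phi_cst c : phi (cst c) = 0.
  apply: phiP; exists c, (fun=> 0); split=> //.
  by rewrite big1 ?addr0 // => j _; rewrite scale0r.
have phi_chi j : phi (chi j) = (i == j)%:R.
  apply: phiP; exists 0, (fun l => (l == j)%:R); split=> //.
  rewrite (bigD1 j) //= eqxx scale1r big1 => [|l /negPf->]; last by rewrite scale0r.
  by apply: cochainP => x; rewrite !cochainD cst_cochainE cochain0 addr0 add0r.
have [X XE] := functional_operator compactG phi.
exists X; split=> [c|j]; apply: cochainP => x; rewrite operatorE XE.
  by rewrite translate_cst phi_cst.
by rewrite translate_chi linearB /= phi_chi phi_cst subr0.
Qed.

Variable X : 'I_n -> operator F G.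
Hypothesis X_cst : forall i c, X i (cst c) = 0.
Hypothesis X_chi : forall i j, X i (chi j) = cst (i == j)%:R.

Local Notation Cn := ('I_n -> C).

(** The map [C -> C^n] of the resolution of the constants. *)
Definition coboundary0 (f : C) : Cn := fun i => X i f.

Lemma coboundary0_linear : linear coboundary0.
Proof. by move=> c f g; apply: funext => i; exact: (linearP (X i)). Qed.

HB.instance Definition _ := GRing.isLinear.Build F C Cn _ coboundary0
  coboundary0_linear.

Definition translates (g : G) (u : Cn) : Cn := fun i => translate g (u i).

Lemma coboundary0_translate g f : coboundary0 (translate g f) = translates g
  (coboundary0 f).
Proof. by apply: funext => i; exact: operator_translate. Qed.

(** Otherwise, by nilpotence, the kernel contains a nonconstant [u] that is fixed modulo constants.
    Up to a constant [u] is a homomorphism, thus a combination of the [chi i], whose coefficients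
    are detected by the [X i]. *)
Lemma coboundary0_ker f : coboundary0 f = 0 -> f = cst (f 1%g).
Proof.
move=> f0; suff : exists c, f = cst c by case=> c ->.
apply: contrapT => fW; have [m fm] := cochain_nilpotent pF G_pro_p f.
have [||u [Pu Wu uW]] := nilpotent_fixed_vector
    (P := fun f => coboundary0 f = 0) (W := fun f => exists c, f = cst c) _ _ fm f0 fW.
- move=> g u u0; rewrite linearB /= coboundary0_translate u0 subr0.
  by apply: funext => i; exact: linear0.
- by exists 0; exact: cochainP.
change C in u; apply: Wu; pose h : C := u - cst (u 1%g).
have [|c hc] := @chi_span h; first exact: translate_additive.
have c0 i : c i = 0.
  have : X i h = 0.
    by rewrite linearB /= X_cst subr0 -[LHS]/(coboundary0 u i) Pu.
  move=> /(congr1 (fun f : C => f 1%g)); rewrite hc linear_sum cochain_sum /=.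
  rewrite (bigD1 i) //= linearZ /= cochainZ X_chi eqxx cst_cochainE mulr1.
  rewrite big1 ?addr0 // => j ji.
  by rewrite linearZ /= cochainZ X_chi eq_sym (negPf ji) cst_cochainE mulr0.
exists (u 1%g); apply/eqP; rewrite -subr_eq0; apply/eqP.
by rewrite -/h hc big1 // => i _; rewrite c0 scale0r.
Qed.

Definition inject (i : 'I_n) (f : C) : Cn := fun j => if j == i then f else 0.

Lemma inject_linear i : linear (inject i).
Proof.
move=> c f g; apply: funext => j; rewrite /inject /= !fctE.
by case: eqP => // _; rewrite scaler0 addr0.
Qed.

HB.instance Definition _ i :=
  GRing.isLinear.Build F C Cn _ (inject i) (inject_linear i).

Lemma inject_sum (u : Cn) : u = \sum_i inject i (u i).
Proof.
apply: funext => j; rewrite fct_sumE (bigD1 j) //= big1 => [|i ij].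
  by rewrite /inject eqxx addr0.
by rewrite /inject eq_sym (negPf ij).
Qed.

Lemma functional_operators (phi : {scalar Cn}) : exists T : 'I_n -> operator F G,
  forall u, phi u = \sum_i cochain_fun (T i (u i)) 1%g.
Proof.
have /choice[T TE] i : exists T : operator F G, forall f, T f 1%g = phi (inject i f).
  pose psi f : F^o := phi (inject i f).
  have psi_lin : scalar psi by move=> c f g; rewrite /psi !linearP.
  pose m := GRing.isLinear.Build _ _ _ _ psi psi_lin.
  exact: (functional_operator compactG (HB.pack psi m : {scalar C})).
exists T => u; rewrite {1}(inject_sum u) linear_sum.
by apply: eq_bigr => i _; rewrite TE.
Qed.

(** The functional [f |-> T f 1 - t * f 1] kills the constants, which are the kernel of
    [coboundary0]. It therefore factors through [coboundary0], and an extension to [C^n] is given by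
    the operators [v i]. *)
Lemma operator_augmentation (T : operator F G) :
  exists c (v : 'I_n -> operator F G), T = c *: 1 + \sum_i v i * X i.
Proof.
pose t := T (cst 1) 1%g.
pose R (u : Cn) a := exists2 f, u = coboundary0 f & a = T f 1%g - t * f 1%g.
have Rlin : linear_relation R.
  split=> [|c _ _ _ _ [f -> ->] [g -> ->]|_ [f /esym f0 ->]].
  - by exists 0; rewrite !linear0 // !cochain0 mulr0 subr0.
  - exists (c *: f + g); first by rewrite linearP.
    by rewrite linearP !cochainDZ; ring.
  - by rewrite {1}(coboundary0_ker f0) cst_cochainZ linearZ /= cochainZ mulrC subrr.
have [phi phiP] := linear_relation_extend Rlin.
have [v vP] := functional_operators phi.
exists t, v; apply: operator_ext => f.
rewrite operatorD cochainD operatorZ operator1 cochainZ operator_sum cochain_sum.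
have := vP (coboundary0 f); rewrite (phiP _ (T f 1%g - t * f 1%g)); last by exists f.
by move=> /eqP; rewrite subr_eq addrC => /eqP.
Qed.

Lemma coboundary0_chi j : coboundary0 (chi j) = inject j (cst 1).
Proof.
apply: funext => i; rewrite /coboundary0 /inject X_chi.
by case: eqP => // _; exact: cochainP.
Qed.

Lemma translatesM g h u : translates (g * h)%g u = translates g (translates h u).
Proof. by apply: funext => i; exact: translateM. Qed.

Lemma translates_linear g : linear (translates g).
Proof. by move=> c u v; apply: funext => i; exact: (linearP (translate g)). Qed.

HB.instance Definition _ g :=
  GRing.isLinear.Build F Cn Cn _ (translates g) (translates_linear g).

Lemma translates_near u g : \forall h \near g, translates h u = translates g u.
Proof.
have : \forall h \near g, forall i, translate h (u i) = translate g (u i).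
  by apply: filter_forall => i; exact: translate_near.
by apply: filterS => h hP; exact: funext.
Qed.

(** A fixed vector has constant entries, and the constant vectors are the images of the combinations
    of the [chi j]. *)
Lemma coboundary0_fixed w : (forall g, translates g w = w) ->
  exists f, w = coboundary0 f.
Proof.
move=> w_fix; exists (\sum_j (w j 1%g) *: chi j).
rewrite {1}(inject_sum w) linear_sum; apply: eq_bigr => j _.
rewrite linearZ /= coboundary0_chi -linearZ; congr (inject j _).
rewrite -cst_cochainZ; apply: translate_fixed => g.
by rewrite -[LHS]/(translates g w j) w_fix.
Qed.

Local Notation H2_class := (homology_class (@bar1 F G) (g := @bar2 F G)).

Variables (e2 : H2 F G) (chiZ : 'I_n -> cycles (@bar1 F G)).
Hypothesis e2_span : forall v : H2 F G, exists c, v = c *: e2.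
Hypothesis e2_free : forall c, c *: e2 = 0 -> c = 0.
Hypothesis chiZ_val : forall i, val (chiZ i) = chi i.
Variable B : 'I_n -> 'I_n -> F.
Hypothesis cup_chi : forall i j,
  H2_class (cup_cocycles (chiZ i) (chiZ j)) = B i j *: e2.

(* The connecting map [(C^n / im)^G -> H^2(G, F_p)], as a relation. *)
Definition connecting (u : Cn) (c : F) :=
  exists (Phi : G -> C) (z : cycles (@bar2 F G)), [/\
    forall g, \forall h \near g, Phi h = Phi g,
    forall g, coboundary0 (Phi g) = translates g u - u,
    forall g h, translate g (Phi h) - Phi (g * h)%g + Phi g =
      cst (cochain_fun (val z) (g, h)) &
    H2_class z = c *: e2].

Lemma near_cochain (h : G -> F) : (forall g, \forall h' \near g, h h' = h g) ->
  exists f : C, forall x, f x = h x.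
Proof.
move=> hP; have hc : (h : G -> F^o) \in cochain_pred F G by apply/cochain_predP.
by exists (Sub (h : G -> F^o) hc).
Qed.

Lemma connecting_coboundary0 f : connecting (coboundary0 f) 0.
Proof.
exists (fun g => translate g f - f), 0; split=> [g|g|g h|].
- by apply: filterS (translate_near compactG f g) => h ->.
- by rewrite linearB /= coboundary0_translate.
- apply: cochainP => x; rewrite linearB /= -translateM.
  by rewrite cochainD !cochainB cst_cochainE cochain0; ring.
- by rewrite linear0 scale0r.
Qed.

Lemma connecting_linear : linear_relation connecting.
Proof.
split=> [|c u a v b [Phi [z [PhiN PhiE PhiZ zE]]] [Psi [y [PsiN PsiE PsiZ yE]]]|c].
- by rewrite -(linear0 coboundary0); exact: connecting_coboundary0.
- exists (fun g => c *: Phi g + Psi g), (c *: z + y); split=> [g|g|g h|].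
  + by apply: filterS2 (PhiN g) (PsiN g) => h -> ->.
  + by rewrite linearP /= PhiE PsiE linearP /= scalerBr opprD addrACA.
  + have vE : val (c *: z + y) = c *: val z + val y by [].
    apply: cochainP => x; rewrite cst_cochainE vE cochainDZ.
    have e1 := congr1 (fun f : C => f x) (PhiZ g h).
    have e2' := congr1 (fun f : C => f x) (PsiZ g h).
    rewrite cst_cochainE in e1; rewrite cst_cochainE in e2'; rewrite -e1 -e2'.
    by rewrite !(cochainD, cochainN, cochainZ, translateE); ring.
  + have -> : H2_class (c *: z + y) = c *: H2_class z + H2_class y.
      exact: homology_class_linear.
    by rewrite zE yE scalerDl scalerA.
(* For [u = 0] all [Phi g] are constants, and as a cochain in [g] they bound [z]. *)
- move=> [Phi [z [PhiN PhiE PhiZ zE]]]; apply: e2_free;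
  rewrite -zE -(linear0 (H2_class)).
  apply/homology_classE.
  have [b bE] : exists b : C, forall g, b g = Phi g 1%g.
    by apply: near_cochain => g; apply: filterS (PhiN g) => h ->.
  exists b; rewrite subr0; apply: cochainP => -[g h]; rewrite bar1E !bE.
  have := congr1 (fun f : C => f 1%g) (PhiZ g h); rewrite cst_cochainE => <-.
  rewrite cochainD cochainB translateE.
  have cstP k : Phi k = cst (Phi k 1%g).
    by apply: coboundary0_ker; rewrite PhiE linear0 subr0.
  by rewrite [in RHS](cstP h).
Qed.

(** If [z] is the coboundary of [a], then [Phi - a] is a cocycle with values in [C], hence the
    coboundary of some [f]. Then [u - coboundary0 f] is fixed by [G], and [coboundary0_fixed]
    applies. *)
Lemma connecting_ker u : connecting u 0 -> exists f, u = coboundary0 f.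
Proof.
move=> [Phi [z [PhiN PhiE PhiZ zE]]].
have [a aE] : exists a : C, bar1 a = val z.
  have /homology_classE[a aE] : H2_class z = H2_class 0 by rewrite zE scale0r linear0.
  by exists a; rewrite [LHS]aE subr0.
have zaE g h : cochain_fun (val z) (g, h) = a h - a (g * h)%g + a g.
  by rewrite -aE bar1E.
pose Psi g : C := Phi g - cst (a g).
have PsiE x y : Psi x y = Phi x y - a x by [].
have PsiM g h : Psi (g * h)%g = translate g (Psi h) + Psi g.
  apply: cochainP => x; have := congr1 (fun f : C => f x) (PhiZ g h).
  rewrite cst_cochainE zaE cochainD cochainB cochainD !translateE !PsiE.
  by move/eqP; rewrite -subr_eq0 => /eqP e; apply/eqP;
    rewrite -subr_eq0 -oppr_eq0 -e; apply/eqP; ring.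
(* The cocycle [Psi] bounds since [H^1(G, C) = 0]. *)
have [f fE] : exists f : C, forall x, f x = - Psi x x.
  apply: near_cochain => x.
  apply: filterS3 (PhiN x) (cochain_near a x) (cochain_near (Phi x) x) => y e1 e2' e3.
  by rewrite !PsiE e1 e2' e3.
(* This is the cocycle identity for the product of [g] and [g^-1 * x], evaluated at [x]. *)
have PsiN g : translate g f - f = Psi g.
  apply: cochainP => x; rewrite cochainB translateE !fE.
  have := congr1 (fun f : C => f x) (PsiM g (g^-1 * x)%g).
  by rewrite mulKVg cochainD translateE => ->; ring.
have [|f' f'E] := @coboundary0_fixed (u - coboundary0 f).
  move=> g; rewrite linearB /= -coboundary0_translate.
  have -> : translate g f = f + Psi g by rewrite -PsiN addrC subrK.
  have -> : Psi g = Phi g - cst (a g) by [].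
  rewrite linearD linearB /= PhiE.
  have -> : coboundary0 (cst (a g)) = 0 by apply: funext => i; exact: X_cst.
  by rewrite subr0 opprD opprB addrCA [X in _ + X]addrC subrK addrC.
by exists (f + f'); rewrite linearD /= -f'E addrC subrK.
Qed.

Lemma connecting_total u : (forall g, exists f, translates g u - u = coboundary0 f) ->
  exists c, connecting u c.
Proof.
(* One preimage is chosen for each vector of the image, not for each [g], so that [Phi] is locally
   constant along with [translates g u]. *)
move=> uP; have /choice[s sP] v : exists f, (exists f', v = coboundary0 f') ->
  v = coboundary0 f.
  have [[f' vE]|nf] := pselect (exists f', v = coboundary0 f'); first by exists f'.
  by exists 0.
pose Phi g := s (translates g u - u).
have PhiE g : coboundary0 (Phi g) = translates g u - u by rewrite /Phi -sP.
have PhiN g : \forall h \near g, Phi h = Phi g.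
  by apply: filterS (translates_near u g) => h; rewrite /Phi => ->.
pose Z g h : C := translate g (Phi h) - Phi (g * h)%g + Phi g.
have ZE g h : Z g h = cst (Z g h 1%g).
  apply: coboundary0_ker; rewrite linearD linearB /= coboundary0_translate !PhiE.
  rewrite linearB /= -translatesM.
  by rewrite opprB [X in X + _]addrC !addrA !subrK subrr.
have Zval g h x : Z g h x = Phi h (g^-1 * x)%g - Phi (g * h)%g x + Phi g x by [].
pose zf (gh : G * G) : F^o := Z gh.1 gh.2 1%g.
have zfc : zf \in cochain_pred F (G * G)%type.
  apply/cochain_predP => -[g h]; rewrite /zf /=.
  have n1 : \forall t \near (g, h), Phi t.1 = Phi g.
    exact: (@cvg_fst _ _ (nbhs g) (nbhs h) _ _ (PhiN g)).
  have n2 : \forall t \near (g, h), Phi t.2 = Phi h.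
    exact: (@cvg_snd _ _ (nbhs g) (nbhs h) _ _ (PhiN h)).
  have n3 : \forall t \near (g, h), Phi (t.1 * t.2)%g = Phi (g * h)%g.
    exact: (@mulg_continuous G (g, h) _ (PhiN (g * h)%g)).
  have n4 : \forall t \near (g, h), Phi h t.1^-1%g = Phi h g^-1%g.
    apply: (@cvg_fst _ _ (nbhs g) (nbhs h) _ [set g' | Phi h g'^-1%g = Phi h g^-1%g]).
    exact: (@invg_continuous G g _ (cochain_near (Phi h) g^-1%g)).
  apply: filterS (filterI (filterI n1 n2) (filterI n3 n4)) => -[g' h'] /=.
  by move=> [[e1 e2'] [e3 e4]]; rewrite !Zval !mulg1 e1 e2' e3 e4.
have zE g h : (Sub zf zfc : cochain F (G * G)%type) (g, h) = Z g h 1%g by [].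
have zc : (Sub zf zfc : cochain F (G * G)%type) \in cycle_pred (@bar2 F G).
  apply/eqP/cochainP => -[[x y] w]; rewrite bar2E !zE.
  (* [Z y w] is constant; its value at [x^-1] is the one that matches the translation by [x]. *)
  have -> : Z y w 1%g = Z y w x^-1%g by rewrite [in RHS]ZE.
  by rewrite !Zval !mulg1 invgM !mulgA cochain0; ring.
pose z : cycles (@bar2 F G) := Sub (Sub zf zfc : cochain F (G * G)%type) zc.
have [c cP] := e2_span (H2_class z).
by exists c, Phi, z; split=> // g h; rewrite -/(Z g h) ZE.
Qed.

(** Translation by [g] changes the vector by [- chi i g] at the place [j], which is the image of
    [- chi i g *: chi j]. The resulting cocycle is the cup product of [chi j] and [chi i], in this
    order. *)
Lemma connecting_cup i j : connecting (inject j (chi i)) (B j i).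
Proof.
exists (fun g => - chi i g *: chi j), (cup_cocycles (chiZ j) (chiZ i));
  split=> [g|g|g h|].
- by apply: filterS (cochain_near (chi i) g) => h ->.
- rewrite linearZ /= coboundary0_chi -linearZ.
  have -> : translates g (inject j (chi i)) = inject j (translate g (chi i)).
    apply: funext => l; rewrite /translates /inject; case: eqP => // _.
    exact: linear0.
  rewrite -linearB translate_chi; congr (inject j _).
  by rewrite -cst_cochainZ addrAC subrr add0r; exact: cochainP.
- rewrite linearZ /= translate_chi; apply: cochainP => x.
  rewrite cochainD cochainB !cochainZ cochainB !cst_cochainE cup_cochainsE !chiZ_val
    chi_hom.
  by ring.
- exact: cup_chi.
Qed.

Lemma translates_nilpotent (u : Cn) : exists m, nilpotent_at translates m u.
Proof.
have /choice[m mP] i := cochain_nilpotent pF G_pro_p (u i).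
exists (\max_i m i)%N.
have : forall i, nilpotent_at translate (\max_i m i) (u i).
  by move=> i; apply: nilpotent_at_le (mP i); exact: leq_bigmax.
elim: (\max_i m i)%N u {mP} => [|l IH] u ul; first exact: funext.
by move=> g; apply: IH => i; exact: ul.
Qed.

(* A minimal resolution of [F] ends with a free module of rank one. *)
Lemma cyclic_syzygies : exists r : 'I_n -> operator F G, [/\
  \sum_i r i * X i = 0,
  forall v : 'I_n -> operator F G, \sum_i v i * X i = 0 ->
    exists mu, forall i, v i = mu * r i,
  forall i c, r i (cst c) 1%g = 0 &
  forall i j, r i (chi j) 1%g = B i j].
Proof.
(* The connecting map is extended to a functional on [C^n], whose operators are the generator
   [r]. *)
have [l lP] := linear_relation_extend connecting_linear.
have [r rE] := functional_operators l.
have l_coboundary0 f : l (coboundary0 f) = 0 by exact/lP/connecting_coboundary0.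
have sum_inject (v : 'I_n -> operator F G) i f :
    \sum_j v j (inject i f j) = v i f.
  rewrite (bigD1 i) //= big1 => [|j /negPf ji]; first by rewrite /inject eqxx addr0.
  by rewrite /inject ji linear0.
have rl i f : r i f 1%g = l (inject i f).
  by rewrite rE -cochain_sum sum_inject.
have r_translate u x : cochain_fun (\sum_i r i (u i)) x = l (translates x^-1%g u).
  rewrite rE cochain_sum; apply: eq_bigr => i _.
  by rewrite operatorE.
(* Exactness at [C^n]: a counterexample yields one that is fixed modulo the image and on which [l]
   vanishes. There [l] is the connecting map, whose kernel is the image. *)
have exact_r u : \sum_i r i (u i) = 0 -> exists f, u = coboundary0 f.
  move=> u0; apply: contrapT => uW; have [m um] := translates_nilpotent u.
  have Pu g : l (translates g u) = 0.
    by have := r_translate u g^-1%g; rewrite u0 invgK cochain0 => <-.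
  have [||u' [Pu' Wu' uW']] := nilpotent_fixed_vector
    (P := fun u : Cn => forall g, l (translates g u) = 0)
    (W := fun u : Cn => exists f, u = coboundary0 f) _ _ um Pu uW.
  - move=> g v Pv h; rewrite !linearB /= -translatesM.
    by rewrite !Pv subrr.
  - by exists 0; rewrite linear0.
  have [c cP] := connecting_total uW'; case: Wu'.
  have c0 : c = 0.
    rewrite -(lP _ _ cP) -(Pu' 1%g); congr (l _).
    by apply: funext => i; rewrite /translates translate1.
  by move: cP; rewrite c0; exact: connecting_ker.
exists r; split.
- apply: operator_ext => f; rewrite operator_sum cochain_sum operator0 cochain0.
  by rewrite -[RHS](l_coboundary0 f) rE; apply: eq_bigr.
- move=> v v0.
  (* The functional given by [v] vanishes on the image of [coboundary0], the kernel of [r]. Hence it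
     factors through [r], and an extension of the factor to [C] is [mu]. *)
  pose R (f : C) (c : F) := exists2 u : Cn, f = \sum_i r i (u i) &
    c = \sum_i cochain_fun (v i (u i)) 1%g.
  have Rlin : linear_relation R.
    split=> [|c _ _ _ _ [u -> ->] [u' -> ->]|_ [u /esym /exact_r[f ->] ->]].
    + exists 0; first by rewrite big1 // => i _; exact: linear0.
      by rewrite big1 // => i _; rewrite linear0.
    + exists (c *: u + u').
        rewrite scaler_sumr -big_split; apply: eq_bigr => i _ /=.
        by rewrite -linearP.
      rewrite mulr_sumr -big_split; apply: eq_bigr => i _ /=.
      by rewrite -cochainDZ -linearP.
    + have := congr1 (fun T : operator F G => T f 1%g) v0.
      by rewrite operator_sum cochain_sum operator0 cochain0.
  have [phi phiP] := linear_relation_extend Rlin.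
  have [mu muE] := functional_operator compactG phi.
  exists mu => i; apply: operator_ext => f; rewrite operatorM muE.
  apply/esym/phiP; exists (inject i f); first by rewrite sum_inject.
  by rewrite -cochain_sum sum_inject.
- move=> i c; rewrite rl -(l_coboundary0 (c *: chi i)); congr (l _).
  by rewrite linearZ /= coboundary0_chi -linearZ; congr (inject i _);
    exact: cst_cochainZ.
- by move=> i j; rewrite rl; apply: lP; exact: connecting_cup.
Qed.

Variables a b : 'I_n.
Local Notation wfilt := (wfilt a X).

Lemma operator_cst (T : operator F G) c : T (cst c) 1%g = c * T (cst 1) 1%g.
Proof. by rewrite cst_cochainZ linearZ. Qed.

Lemma wfilt2 (T : operator F G) : T (cst 1) 1%g = 0 ->
  exists2 v : 'I_n -> operator F G, T = \sum_i v i * X i & wfilt 2 T.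
Proof.
move=> T0; have [c [v TE]] := operator_augmentation T.
have c0 : c = 0.
  move: T0; rewrite TE operatorD cochainD operatorZ operator1 cochainZ cst_cochainE.
  rewrite operator_sum big1 ?addr0 ?mulr1 // => i _.
  by rewrite operatorM X_cst linear0.
exists v; first by rewrite TE c0 scale0r add0r.
rewrite TE c0 scale0r add0r; apply: WfiltS => i.
by rewrite (_ : (_ - _)%N = 0%N); [exact: Wfilt0|have := wtP a i; lia].
Qed.

(** In [T = sum_i v i * X i], the value at [chi i] is the augmentation of [v i]. So [T] lies in the
    square of the augmentation ideal, whose generators have weight at least 2. *)
Lemma wfilt4 (T : operator F G) : T (cst 1) 1%g = 0 ->
  (forall i, T (chi i) 1%g = 0) -> wfilt 4 T.
Proof.
move=> T0 Tchi; have [v TE _] := wfilt2 T0; rewrite TE; apply: WfiltS => i.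
have [|_ _] := @wfilt2 (v i); last first.
  by apply: wfilt_le; have := wtP a i; lia.
rewrite -(Tchi i) TE operator_sum cochain_sum (bigD1 i) //= operatorM X_chi eqxx.
rewrite big1 ?addr0 // => j ji; rewrite operatorM X_chi (negPf ji).
by rewrite operator_cst mul0r.
Qed.

(** Each [X i] lowers the degree of nilpotence of a function, and an operator of weight [3 * m] is a
    sum of products that end with [m] of the [X i]. *)
Lemma wfilt_separated (T : operator F G) : (forall m, wfilt m T) -> T = 0.
Proof.
have Xnil i m (f : C) : nilpotent_at translate m.+1 f ->
  nilpotent_at translate m (X i f).
  elim: m f => [f f1|m IH f fm g].
    have -> : f = cst (f 1%g).
      apply: translate_fixed => g; apply/eqP; rewrite -subr_eq0; apply/eqP; exact: f1.
    exact: X_cst.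
  by rewrite -operator_translate -linearB; apply: IH; exact: fm.
have kill m (S : operator F G) (f : C) : wfilt (3 * m) S ->
  nilpotent_at translate m f -> S f = 0.
  elim: m S f => [S f _ ->|m IH S f mS fm]; first exact: linear0.
  have [//|v vm ->] := wfiltE _ mS; rewrite operator_sum big1 // => i _.
  rewrite operatorM; apply: IH (Xnil i m f fm).
  by apply: wfilt_le (vm i); have := wtP a i; lia.
move=> TP; apply: operatorP => f.
have [m fm] := cochain_nilpotent pF G_pro_p f.
by rewrite operator0; exact: kill (TP _) fm.
Qed.

Hypothesis ba : b != a.
Hypotheses (Bab : B a b != 0) (Bba : B b a != 0).
Hypotheses (Bai : forall i, i != b -> B a i = 0) (Bia : forall i, i != b -> B i a = 0).

(** In the relation [sum_i r i * X i = 0], the terms at [a] and [b] start with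
    [B a b *: (X b * X a)] and [B b a *: (X a * X b)], of weight 5. The rest has weight 6, because
    [r i] has no linear term in [X a] for [i] other than [b]. *)
Theorem operator_domain (S T : operator F G) : S != 0 -> T != 0 -> S * T != 0.
Proof.
have [r [rX syz r_cst r_chi]] := cyclic_syzygies.
have rlead i : wfilt 4 (r i - \sum_j B i j *: X j).
  apply: wfilt4 => [|l]; rewrite operatorB cochainB operator_sum cochain_sum.
    rewrite r_cst big1 ?subr0 // => j _.
    by rewrite operatorZ X_cst scaler0.
  rewrite r_chi (bigD1 l) //= operatorZ cochainZ X_chi eqxx cst_cochainE mulr1.
  rewrite big1 ?addr0 ?subrr // => j jl.
  by rewrite operatorZ cochainZ X_chi (negPf jl) cst_cochainE mulr0.
have Xw i : wfilt (wt a i) (X i).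
  by rewrite -[X i]mul1r; exact: (@wfilt_mulx _ _ _ a X 0 i 1 (Wfilt0 _ _ _)).
have ra : wfilt 4 (r a - B a b *: X b).
  have := rlead a; rewrite (bigD1 b) //= big1 ?addr0 // => j jb.
  by rewrite Bai // scale0r.
have ri i : wfilt 2 (r i).
  rewrite -(subrK (\sum_j B i j *: X j) (r i)); apply: wfiltD.
    exact: wfilt_le (rlead i).
  apply: wfilt_sum => j _; apply: wfiltZ; apply: wfilt_le (Xw j).
  by have := wtP a j; lia.
have rb : wfilt 3 (r b - B b a *: X a).
  have -> : r b - B b a *: X a =
      (r b - \sum_j B b j *: X j) + \sum_(j | j != a) B b j *: X j.
    by rewrite (bigD1 a) //= opprD addrA subrK.
  apply: wfiltD; first exact: wfilt_le (rlead b).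
  by apply: wfilt_sum => j ja; apply: wfiltZ; rewrite -(wt_neq ja); exact: Xw.
have rc i : i != a -> i != b -> wfilt 3 (r i).
  move=> ia ib; rewrite -(subrK (\sum_j B i j *: X j) (r i)); apply: wfiltD.
    exact: wfilt_le (rlead i).
  rewrite (bigD1 a) //= Bia // scale0r add0r.
  by apply: wfilt_sum => j ja; apply: wfiltZ; rewrite -(wt_neq ja); exact: Xw.
have swap : wfilt 6 (B a b *: (X b * X a) + B b a *: (X a * X b)).
  have -> : B a b *: (X b * X a) + B b a *: (X a * X b) =
    - ((r a - B a b *: X b) * X a + (r b - B b a *: X a) * X b
       + \sum_(i | (i != a) && (i != b)) r i * X i).
    move: rX; rewrite (bigD1 a) //= (bigD1 b) //= => rX.
    rewrite addrA in rX.
    rewrite !mulrBl -!scalerAl addrACA -opprD.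
    by rewrite (addrAC (r a * X a + r b * X b)) rX sub0r opprK.
  have split6 i u : i != a -> wfilt 3 u -> wfilt 6 (u * X i).
    by move=> ia /(wfilt_mulx i); rewrite (wt_neq ia).
  apply: wfiltN; apply: wfiltD; first apply: wfiltD.
  - by have := wfilt_mulx a ra; rewrite wt_a.
  - exact: split6.
  - by apply: wfilt_sum => i /andP[ia ib]; apply: split6 => //; exact: rc.
exact: (weighted_domain operator_augmentation ba Bab Bba swap wfilt_separated syz ri
  ra).
Qed.

End DemushkinResolution.

(** * The cup product form *)

Section AdaptedBasis.
Variables (F : fieldType) (V : lmodType F) (n : nat).
Implicit Types (z : 'I_n -> V) (c d : 'I_n -> F).

Definition is_basis z :=
  (forall v, exists c, v = \sum_i c i *: z i) /\
  (forall c, \sum_i c i *: z i = 0 -> forall i, c i = 0).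

Lemma basis_replace z a c : is_basis z -> c a != 0 ->
  is_basis (fun i => if i == a then \sum_j c j *: z j else z i).
Proof.
move=> [zspan zfree] ca.
have sumE d : \sum_i d i *: (if i == a then \sum_j c j *: z j else z i) =
    \sum_i (d a * c i + (if i == a then 0 else d i)) *: z i.
  under [RHS]eq_bigr do rewrite scalerDl -scalerA.
  rewrite big_split /= -scaler_sumr (bigD1 a) //= eqxx; congr (_ + _).
  rewrite [RHS](bigD1 a) //= eqxx scale0r add0r.
  by apply: eq_bigr => i /negPf->.
split=> [v|d]; last first.
  rewrite sumE => /zfree d0 i; have da : d a = 0.
    by have /eqP := d0 a; rewrite eqxx addr0 mulf_eq0 (negPf ca) orbF => /eqP.
  have [->//|ia] := eqVneq i a.
  by have := d0 i; rewrite da mul0r add0r (negPf ia).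
have [w ->] := zspan v.
exists (fun i => if i == a then w a / c a else w i - w a / c a * c i).
rewrite sumE; apply: eq_bigr => i _; congr (_ *: _); rewrite eqxx.
have [->|_] := eqVneq i a; first by rewrite addr0 divfK.
by rewrite addrC subrK.
Qed.

Lemma basis_shear z b (t : 'I_n -> F) : is_basis z -> t b = 0 ->
  is_basis (fun i => z i + t i *: z b).
Proof.
move=> [zspan zfree] tb.
have sumE d : \sum_i d i *: (z i + t i *: z b) =
    \sum_i (d i + (if i == b then \sum_j d j * t j else 0)) *: z i.
  under eq_bigr do rewrite scalerDr scalerA.
  under [RHS]eq_bigr do rewrite scalerDl.
  rewrite !big_split /= -scaler_suml; congr (_ + _).
  rewrite [RHS](bigD1 b) //= eqxx [X in _ = _ + X]big1 ?addr0 // => i /negPf->.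
  exact: scale0r.
split=> [v|d]; last first.
  rewrite sumE => /zfree d0; have d0' i : i != b -> d i = 0.
    by move=> ib; have := d0 i; rewrite (negPf ib) addr0.
  move=> i; have [->|/d0'//] := eqVneq i b.
  have := d0 b; rewrite eqxx (bigD1 b) //= tb mulr0 add0r big1 ?addr0 // => j jb.
  by rewrite d0' // mul0r.
have [w ->] := zspan v; pose s := \sum_(j | j != b) w j * t j.
exists (fun i => if i == b then w b - s else w i).
rewrite sumE; apply: eq_bigr => i _; congr (_ *: _).
have [->|_] := eqVneq i b; last by rewrite addr0.
rewrite (bigD1 b) //= tb mulr0 add0r.
have -> : \sum_(j | j != b) (if j == b then w b - s else w j) * t j = s.
  by apply: eq_bigr => j /negPf->.
by rewrite subrK.
Qed.

Variable form : V -> V -> F.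
Hypothesis formP : forall v (s : F) u w, form v (s *: u + w) = s * form v u + form v w.
Hypothesis formC : forall u v, form u v = - form v u.
Hypothesis form_nondeg : forall v, (forall w, form v w = 0) -> v = 0.

Lemma form0 v : form v 0 = 0.
Proof.
have /eqP := formP v 1 0 0; rewrite scaler0 addr0 mul1r -subr_eq0 opprD addrA subrr.
by rewrite add0r oppr_eq0 => /eqP.
Qed.

Lemma form_sum v c z : form v (\sum_i c i *: z i) = \sum_i c i * form v (z i).
Proof.
elim/big_rec2: _ => [|i x y _ <-]; first exact: form0.
by rewrite formP.
Qed.

(** The isotropic vector [v] becomes [x a], a basis vector not orthogonal to it becomes [x b], and
    multiples of [x b] are subtracted from the others to make them orthogonal to [v]. *)
Lemma adapted_basis z v : is_basis z -> v != 0 -> form v v = 0 ->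
  exists a b (x : 'I_n -> V), [/\ b != a, is_basis x, form (x a) (x b) != 0 &
    forall i, i != b -> form (x a) (x i) = 0].
Proof.
move=> zB v0 vv; have [c vE] := zB.1 v.
have [a ca] : exists a, c a != 0.
  apply: contrapT => /forallNP ca; case/eqP: v0; rewrite vE big1 // => i _.
  by have /negP := ca i; rewrite negbK => /eqP ->; rewrite scale0r.
have := basis_replace zB ca; rewrite -vE.
set y := (fun i => _) => yB; have ya : y a = v by rewrite /y eqxx.
have [b vb] : exists b, form v (y b) != 0.
  apply: contrapT => /forallNP vb; case/eqP: v0; apply: form_nondeg => w.
  have [d ->] := yB.1 w; rewrite form_sum big1 // => i _.
  by have /negP := vb i; rewrite negbK => /eqP ->; rewrite mulr0.
have ba : b != a by apply: contraNneq vb => ->; rewrite ya vv.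
pose t i := if i == b then 0 else - (form v (y i) / form v (y b)).
have ta : t a = 0 by rewrite /t eq_sym (negPf ba) ya vv mul0r oppr0.
have tb : t b = 0 by rewrite /t eqxx.
exists a, b, (fun i => y i + t i *: y b); split=> //.
- exact: basis_shear.
- by rewrite ta tb !scale0r !addr0 ya.
move=> i ib; rewrite ta scale0r addr0 ya addrC formP /t (negPf ib).
by rewrite mulNr divfK // addNr.
Qed.

End AdaptedBasis.

(** For odd [p] a skew-symmetric form is alternating. For [p = 2] the map [v |-> form v v] is
    additive, so it vanishes at one of [z i0], [z i1] and their sum. *)
Lemma Fp_isotropic (p : nat) (V : lmodType 'F_p) n (form : V -> V -> 'F_p)
    (z : 'I_n -> V) : prime p -> (1 < n)%N ->
  (forall v c u w, form v (c *: u + w) = c * form v u + form v w) ->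
  (forall u v, form u v = - form v u) -> is_basis z ->
  exists2 v, v != 0 & form v v = 0.
Proof.
move=> p_prime n1 formP formC [_ zfree].
pose i0 := Ordinal (ltnW n1); pose i1 := Ordinal n1.
have neq0 (s : 'F_p) : s *: z i1 + z i0 != 0.
  pose c i : 'F_p := if i == i0 then 1 else if i == i1 then s else 0.
  apply/eqP => e; suff c0 : forall i, c i = 0.
    by have /eqP := c0 i0; rewrite /c eqxx oner_eq0.
  apply: zfree; rewrite /c.
  rewrite (bigD1 i0) //= scale1r (bigD1 i1) //= big1 ?addr0 =>
    [|i /andP[/negPf-> /negPf->]].
    by rewrite addrC.
  by rewrite scale0r.
pose q v := form v v.
have [q0|q0] := eqVneq (q (z i0)) 0.
  by exists (z i0) => //; have := neq0 0; rewrite scale0r add0r.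
have two : (2 : 'F_p) = 0.
  apply/eqP; rewrite -[_ == 0]orbF -(negPf q0) -mulf_eq0 mulr_natl mulr2n.
  by rewrite {1}/q formC addNr.
have p2 : p = 2%N.
  have p2 : (p %| 2)%N by rewrite (dvdn_pcharf (pchar_Fp p_prime)) two.
  by have := dvdn_leq (isT : 0 < 2)%N p2; have := prime_gt1 p_prime; lia.
have F2 (x : 'F_p) : x != 0 -> x = 1.
  rewrite p2 in x *.
  by case: x => -[|[|//]] // ? _; apply: val_inj.
have [q1|/F2 q1] := eqVneq (q (z i1)) 0.
  exists (z i1) => //; apply/eqP => z1.
  suff /zfree/(_ i1)/eqP : \sum_i (i == i1)%:R *: z i = 0 by rewrite eqxx oner_eq0.
  rewrite (bigD1 i1) //= z1 scaler0 add0r big1 // => i /negPf->.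
  exact: scale0r.
exists (1 *: z i1 + z i0); first exact: neq0.
have comm v c u w : form (c *: u + w) v = c * form u v + form w v.
  by rewrite formC formP opprD -mulrN -!formC.
rewrite formP !comm -/(q (z i1)) -/(q (z i0)) (F2 _ q0) q1 (formC (z i0)).
by rewrite !mul1r addrA subrK -two.
Qed.

(** * Demushkin groups of rank one *)

Section RankOne.
Variables (F : fieldType) (p : nat) (G : topologicalGroupType).
Hypotheses (pF : p \in [pchar F]) (G_pro_p : pro_p_group p G).
Local Notation C := (cochain F G).
Local Notation translate := (@translate F G).
Local Notation cst := (@cst_cochain F G).

Variable chi : C.
Hypothesis chi_hom : forall x y, chi (x * y)%g = chi x + chi y.
Hypothesis chi_span : forall f : C, (forall x y, f (x * y)%g = f x + f y) ->
  exists c, f = c *: chi.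
Hypothesis chi_neq0 : chi != 0.
(* I.e. the cup square of [chi] does not vanish. *)
Hypothesis chi_cup : forall (b : C) (s : F),
  (forall x y, b y - b (x * y)%g + b x = s * (chi x * chi y)) -> s = 0.

(** Otherwise there is a further [u] with [translate g u - u = al g + be g *: chi]. Here [be] is a
    homomorphism [s *: chi], and the coboundary of [al] is [s] times the cup square of [chi]. Hence
    [s = 0], so that [u] is a homomorphism up to a constant. *)
Lemma rank_one_cochains (f : C) : exists c d, f = cst c + d *: chi.
Proof.
apply: contrapT => fW; have [m fm] := cochain_nilpotent pF G_pro_p f.
have [||u [_ Wu uW]] := nilpotent_fixed_vector (P := fun=> True)
    (W := fun f : C => exists c d, f = cst c + d *: chi) _ _ fm I fW.
- by [].
- by exists 0, 0; rewrite scale0r addr0; exact: cochainP.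
change C in u; apply: Wu.
have [g0 chi_g0] : exists g0, chi g0 != 0.
  apply: contrapT => /forallNP n0; case/eqP: chi_neq0; apply: cochainP => x.
  by have /negP := n0 x; rewrite negbK => /eqP.
have chi1 : chi 1%g = 0.
  have /eqP := chi_hom 1%g 1%g.
  by rewrite mulg1 -subr_eq0 opprD addrA subrr add0r oppr_eq0 => /eqP.
have chiV x : chi x^-1%g = - chi x by apply/eqP; rewrite -addr_eq0 -chi_hom mulVg chi1.
have [al alP] := choice uW; have [be beP] := choice alP.
have near_u g x : \forall h \near g,
  (translate h u - u : C) x = (translate g u - u : C) x.
  by apply: filterS (translate_near (pro_p_compact G_pro_p) u g) => h ->.
have alE g : al g = (translate g u - u : C) 1%g.
  by rewrite beP cochainD cst_cochainE cochainZ chi1 mulr0 addr0.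
(* Recovering [al] and [be] from values at [1] and [g0] shows that they are locally constant. *)
have beE g : be g = ((translate g u - u : C) g0 - (translate g u - u : C) 1%g) / chi g0.
  rewrite -alE beP cochainD cst_cochainE cochainZ addrC addKr.
  by rewrite mulfK.
have coc g h : (translate (g * h)%g u - u : C) =
    translate g (translate h u - u) + (translate g u - u).
  by rewrite linearB /= translateM addrA subrK.
have translate_affine g c d : translate g (cst c + d *: chi) =
    cst (c - d * chi g) + d *: chi.
  apply: cochainP => x.
  rewrite translateE !cochainD !cst_cochainE !cochainZ chi_hom chiV; ring.
have alM g h : al (g * h)%g = al h + al g - be h * chi g.
  rewrite alE coc beP translate_affine beP !cochainD !cst_cochainE !cochainZ chi1; ring.
have beM g h : be (g * h)%g = be g + be h.
  rewrite beE coc !beP translate_affine !cochainD !cst_cochainE !cochainZ chi1.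
  by apply: (mulIf chi_g0); rewrite divfK //; ring.
have [be' be'E] : exists f : C, forall x, f x = be x.
  by apply: near_cochain => g; apply: filterS2 (near_u g g0) (near_u g 1%g) => h e1 e2;
     rewrite !beE e1 e2.
have [al' al'E] : exists f : C, forall x, f x = al x.
  by apply: near_cochain => g; apply: filterS (near_u g 1%g) => h e1; rewrite !alE e1.
have [s sE] : exists s, be' = s *: chi.
  by apply: chi_span => x y; rewrite !be'E beM.
have beS x : be x = s * chi x by rewrite -be'E sE cochainZ.
have s0 : s = 0.
  by apply: (chi_cup (b := al')) => x y; rewrite !al'E alM beS; ring.
have [|d dE] := chi_span (f := u - cst (u 1%g)).
  apply: translate_additive => g; exists (al g).
  by rewrite beP beS s0 mul0r scale0r addr0.
by exists (u 1%g), d; rewrite -dE addrC subrK.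
Qed.

Lemma indicator_cochain (A : set G) : clopen A ->
  exists f : C, forall x, f x = if `[< A x >] then 1 else 0.
Proof.
move=> [oA cA]; apply: near_cochain => x.
have [Ax|nAx] := pselect (A x).
  have : \forall y \near x, A y by apply: open_nbhs_nbhs; split.
  by apply: filterS => y Ay; rewrite !asboolT.
have : \forall y \near x, ~ A y.
  by apply: open_nbhs_nbhs; split=> //; exact: closed_openC.
by apply: filterS => y Ay; rewrite !asboolF.
Qed.

(** The kernel of [chi] is connected, hence trivial, and it contains all [p]-th powers. Without
    torsion, [G] would be trivial, contrary to [chi != 0]. *)
Lemma rank_one_torsion : ~ torsion_free G.
Proof.
move=> tf; case/eqP: chi_neq0; apply: cochainP => g.
have chiX k : chi (g ^+ k)%g = k%:R * chi g.
  elim: k => [|k IH]; last by rewrite expgS chi_hom IH mulrSr mulrDl mul1r addrC.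
  have /eqP := chi_hom 1%g 1%g.
  rewrite mulg1 -subr_eq0 opprD addrA subrr add0r oppr_eq0 => /eqP.
  by rewrite expg0 mul0r.
pose H : set G := [set x | chi x = 0].
have oH : open H.
  rewrite openE => x /= Hx; apply: filterS (cochain_near chi x) => y e.
  by rewrite /H /= e.
have cH : closed H.
  rewrite -(setCK H); apply: open_closedC; rewrite openE => x /= Hx.
  by apply: filterS (cochain_near chi x) => y e; rewrite /H /= e.
have H1 : H 1%g by have := chiX 0%N; rewrite expg0 mul0r.
(* A clopen subset of [H] is clopen in [G], and its indicator function, an
   affine function of [chi], is constant on [H]. *)
have conn : connected H.
  move=> A [x Ax] [U oU AU] [V cV AV].
  have cloA : clopen A.
    by split; [rewrite AU; exact: openI|rewrite AV; exact: closedI].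
  have [f fE] := indicator_cochain cloA.
  have [c [d fcd]] := rank_one_cochains f.
  have fH y : H y -> f y = c.
    by move=> Hy; rewrite fcd cochainD cst_cochainE cochainZ Hy mulr0 addr0.
  have AH : A `<=` H by rewrite AU => y [].
  apply/seteqP; split=> // y Hy; have := fH y Hy; rewrite -(fH x (AH _ Ax)) !fE.
  rewrite (asboolT Ax); case: ifP => [/asboolP//|_ /esym/eqP].
  by rewrite oner_eq0.
have [[_ _ tdG] _] := G_pro_p.
have gp : (g ^+ p = 1)%g.
  have : H (g ^+ p)%g by rewrite /H /= chiX pcharf0 // mul0r.
  move=> /(connected_component_max H1 (@subsetT _ H) conn).
  by rewrite tdG.
have p0 : (0 < p)%N by exact: prime_gt0 (pcharf_prime pF).
by rewrite (tf _ _ p0 gp); exact: H1.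
Qed.

End RankOne.

(** * The cup product as a bilinear form on homomorphisms *)

Section CupForm.
Variables (F : fieldType) (G : topologicalGroupType).
Local Notation Z1 := (cycles (@bar1 F G)).
Local Notation H1_class := (homology_class (\0 : {linear F^o ->
  cochain F G}) (g := @bar1 F G)).
Local Notation H2_class := (homology_class (@bar1 F G) (g := @bar2 F G)).

Lemma H1_class_inj : injective H1_class.
Proof.
move=> u v /homology_classE[s /esym/eqP]; rewrite subr_eq0 => /eqP.
exact: val_inj.
Qed.

Lemma H1_basis n (e : 'I_n -> H1 F G) :
  (forall v, exists! c : 'I_n -> F, v = \sum_i c i *: e i) ->
  is_basis (fun i => repr (e i) : Z1).
Proof.
move=> eP; have sumE c : H1_class (\sum_i c i *: (repr (e i) : Z1)) = \sum_i c i *: e i.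
  rewrite linear_sum; apply: eq_bigr => i _; rewrite linearZ /=.
  by rewrite homology_class_repr.
split=> [z|c c0 i].
  have [c [cE _]] := eP (H1_class z); exists c; apply: H1_class_inj.
  by rewrite sumE.
have [c' [_ c'U]] := eP 0.
have -> : c = (fun=> 0).
  rewrite -(c'U c); last by rewrite -sumE c0 linear0.
  by apply: c'U; rewrite big1 // => j _; rewrite scale0r.
by [].
Qed.

Lemma cup_cocyclesP (u v w : Z1) (s : F) :
  cup_cocycles u (s *: v + w) = s *: cup_cocycles u v + cup_cocycles u w.
Proof.
apply: val_inj; apply: cochainP => -[x y].
have -> : val (s *: cup_cocycles u v + cup_cocycles u w) =
  s *: val (cup_cocycles u v) + val (cup_cocycles u w) by [].
rewrite cochainDZ !cup_cochainsE.
have -> : val (s *: v + w) = s *: val v + val w by [].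
rewrite cochainDZ; ring.
Qed.

(** The sum of the two cup products is the coboundary of the pointwise product [- (u * v)]. *)
Lemma cup_cocyclesC (u v : Z1) : H2_class (cup_cocycles u v) = - H2_class
  (cup_cocycles v u).
Proof.
apply/eqP; rewrite -addr_eq0 -(raddfD H2_class) -(raddf0 H2_class);
  apply/eqP/homology_classE.
pose f : cochain F G := val u; pose g : cochain F G := val v.
pose w (x : G) : F := - (f x * g x).
have [a aE] : exists a : cochain F G, forall x, a x = w x.
  apply: near_cochain => x.
  by apply: filterS2 (cochain_near f x) (cochain_near g x) => y; rewrite /w => -> ->.
exists a; rewrite subr0; apply: cochainP => -[x y].
have -> : val (cup_cocycles u v + cup_cocycles v u) =
  val (cup_cocycles u v) + val (cup_cocycles v u) by [].
rewrite cochainD !cup_cochainsE bar1E !aE /w.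
have fM := (H1_cocycleP f).1 (valP u); have gM := (H1_cocycleP g).1 (valP v).
rewrite -/f -/g fM gM; ring.
Qed.

Variable e2 : H2 F G.
Hypothesis e2_span : forall v : H2 F G, exists c, v = c *: e2.
Hypothesis e2_free : forall c, c *: e2 = 0 -> c = 0.
Hypothesis cup_nondeg : forall a : H1 F G, (forall b, cup a b = 0) -> a = 0.

Lemma cup_form : exists form : Z1 -> Z1 -> F, [/\
  forall u v, H2_class (cup_cocycles u v) = form u v *: e2,
  forall v (s : F) u w, form v (s *: u + w) = s * form v u + form v w,
  forall u v, form u v = - form v u &
  forall v, (forall w, form v w = 0) -> v = 0].
Proof.
have /choice[f fP] (uv : Z1 * Z1) : exists c,
  H2_class (cup_cocycles uv.1 uv.2) = c *: e2.
  exact: e2_span.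
pose form u v := f (u, v).
have formE u v : H2_class (cup_cocycles u v) = form u v *: e2 by rewrite (fP (u, v)).
have e2_inj c d : c *: e2 = d *: e2 -> c = d.
  move=> /eqP; rewrite -subr_eq0 -scalerBl => /eqP/e2_free/eqP.
  by rewrite subr_eq0 => /eqP.
exists form; split=> //.
- move=> v s u w; apply: e2_inj; rewrite -formE cup_cocyclesP.
  by rewrite homology_class_linear !formE scalerDl scalerA.
- by move=> u v; apply: e2_inj; rewrite -formE cup_cocyclesC formE scaleNr.
move=> v v0; apply: H1_class_inj; rewrite linear0; apply: cup_nondeg => b.
by rewrite -(homology_class_repr b) cup_class formE v0 scale0r.
Qed.

End CupForm.

(** * Zero-divisors, according to the dimension [n] of the first cohomology *)

Theorem theorem1p2 (p : nat) (G : topologicalGroupType)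
    (p_prime : prime p)
    (G_demushkin : demushkin_group p G)
    (G_torsion_free : torsion_free G)
    (a b : completedGroupAlgebra 'F_p G) :
  a != 0 -> b != 0 -> a * b != 0.
Proof.
have [G_pro_p [n [e eP]] [e' e'P] [cup_nondeg _]] := G_demushkin.
apply: (cga_domain (pro_p_compact G_pro_p)) => S T.
have pF := pchar_Fp p_prime.
have e2_span (v : H2 'F_p G) : exists c, v = c *: e' ord0.
  by have [c [-> _]] := e'P v; exists (c ord0); rewrite big_ord1.
have e2_free (c : 'F_p) : c *: e' ord0 = 0 -> c = 0.
  move=> c0; have [c' [_ c'U]] := e'P 0.
  have c'E s : 0 = s *: e' ord0 -> c' ord0 = s.
    by move=> s0; rewrite (c'U (fun=> s)) // big_ord1.
  by rewrite -(c'E c) // (c'E 0) // scale0r.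
have [form [formE formP formC form_nondeg]] := cup_form e2_span e2_free cup_nondeg.
have zB := H1_basis eP.
have chi_hom (z : cycles (@bar1 'F_p G)) x y :
    cochain_fun (val z) (x * y)%g = cochain_fun (val z) x + cochain_fun (val z) y.
  exact: (H1_cocycleP (val z)).1 (valP z) x y.
have val_sum m (x : 'I_m -> cycles (@bar1 'F_p G)) (c : 'I_m -> 'F_p) :
    val (\sum_i c i *: x i) = \sum_i c i *: val (x i).
  by rewrite raddf_sum; apply: eq_bigr.
have chi_span m (x : 'I_m -> cycles (@bar1 'F_p G)) : is_basis x ->
    forall f : cochain 'F_p G, (forall x y, f (x * y)%g = f x + f y) ->
    exists c : 'I_m -> 'F_p, f = \sum_i c i *: val (x i).
  move=> [xspan _] f /H1_cocycleP fM.
  by have [c cE] := xspan (Sub f fM); exists c; rewrite -val_sum -cE SubK.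
have chi_free m (x : 'I_m -> cycles (@bar1 'F_p G)) : is_basis x ->
    forall c : 'I_m -> 'F_p, \sum_i c i *: val (x i) = 0 -> forall i, c i = 0.
  by move=> [_ xfree] c c0; apply: xfree; apply: val_inj; rewrite val_sum.
have [n2|n1] := ltnP 1 n.
  have [v v0 vv] := Fp_isotropic p_prime n2 formP formC zB.
  have [i [j [x [ji xB xij xi]]]] := adapted_basis formP form_nondeg zB v0 vv.
  pose chi l : cochain 'F_p G := val (x l).
  have chiM l : forall g h, chi l (g * h)%g = chi l g + chi l h by exact: chi_hom.
  have [X [X_cst X_chi]] := dual_operators G_pro_p chiM (chi_free _ _ xB).
  apply: (operator_domain pF G_pro_p chiM (chi_span _ _ xB)
    X_cst X_chi e2_span e2_free (chiZ :=
      x) (fun=> erefl) (fun l m => formE (x l) (x m)) ji xij).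
  - by rewrite formC oppr_eq0.
  - exact: xi.
  - by move=> l lj; rewrite formC xi // oppr0.
case: n n1 e eP zB => [|[|//]] _ e eP zB; last first.
  pose z : cycles (@bar1 'F_p G) := repr (e ord0).
  have z0 : z != 0.
    apply/eqP => z0; have /eqP : (1 : 'F_p) = 0; last by rewrite oner_eq0.
    by apply: (zB.2 (fun=> 1) _ ord0); rewrite big_ord1 -/z z0 scaler0.
  suff /(_ G_torsion_free)[] : ~ torsion_free G.
  apply: (@rank_one_torsion 'F_p p G pF G_pro_p (val z)) => //.
  - by move=> f /(chi_span _ _ zB)[c ->]; exists (c ord0); rewrite big_ord1.
  (* For [s != 0] the cup square of [z] would be the coboundary of [s^-1 *: f]. As [z] spans the
     cocycles, it would be orthogonal to all of them. *)
  - move=> f s fs; apply/eqP; apply: contraNT z0 => s0; apply/eqP/form_nondeg => w.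
    have [c ->] := zB.1 w; rewrite big_ord1 -/z -[X in form _ X]addr0 formP.
    rewrite (form0 formP) addr0; suff -> : form z z = 0 by rewrite mulr0.
    apply: e2_free; rewrite -formE -(raddf0 (homology_class (@bar1 'F_p G) (g :=
      @bar2 'F_p G))).
    apply/homology_classE; exists (s^-1 *: f); rewrite subr0.
    apply: cochainP => -[x y]; rewrite bar1E !cochainZ -mulrBr -mulrDr fs.
    by rewrite mulKf.
pose chi l : cochain 'F_p G := val (repr (e l) : cycles (@bar1 'F_p G)).
have chiM l : forall g h, chi l (g * h)%g = chi l g + chi l h by exact: chi_hom.
have [X [X_cst X_chi]] := dual_operators G_pro_p chiM (chi_free _ _ zB).
(* For [n = 0] the sum in [operator_augmentation] is empty, so that all operators are scalars. *)
have scalar U : exists c, U = c *: 1 :> operator 'F_p G.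
  have [c [v ->]] := operator_augmentation pF G_pro_p (chi_span _ _ zB) X_cst X_chi U.
  by exists c; rewrite big_ord0 addr0.
have [[c ->] [d ->]] := (scalar S, scalar T).
rewrite -scalerAl mul1r scalerA !scaler_eq0 oner_eq0 !orbF => c0 d0.
by rewrite mulf_neq0.
Qed.
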